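(* Fix an equation $(f,q,w)$ as in the context and $z\in\mathbb C$ with $z\neq0$. For $a_{12},b_{22}\in\mathbb R$ let $\mathbf A(a_{12},b_{22})$ be the self-adjoint boundary condition with coefficient matrix $\begin{pmatrix}1&a_{12}&0&\bar z\\0&z&-1&b_{22}\end{pmatrix}$, and let $\mathbf S_7=\begin{pmatrix}0&1&0&0\\0&0&-1&b_{22}\end{pmatrix}$, $\mathbf S_8=\begin{pmatrix}1&a_{12}&0&0\\0&0&0&1\end{pmatrix}$. Then the problem with $\mathbf A(a_{12},b_{22})$ has exactly $N$ eigenvalues if $b_{22}(a_{12}-1/f_0)\ne|z|^2$ and exactly $N-1$ otherwise; with $\mathbf S_7$ exactly $N$ if $b_{22}\neq0$ and $N-1$ if $b_{22}=0$; with $\mathbf S_8$ exactly $N$ if $a_{12}-1/f_0\ne0$ and $N-1$ if $a_{12}-1/f_0=0$. Further, writing $\lambda_n(a^{(i)})$ (resp. $\lambda_n(b^{(i)})$) for the eigenvalues with $\mathbf A(a^{(i)},b_{22})$ for fixed $b_{22}$ (resp. $\mathbf A(a_{12},b^{(i)})$ for fixed $a_{12}$): (i) if $b_{22}=0$ and $a^{(1)}<a^{(2)}$: for each $0\le n\le N-2$, $\lambda_n(a^{(1)})\le\lambda_n(a^{(2)})\le\lambda_n(\mathbf S_7)\le\lambda_{n+1}(a^{(1)})$, and $\lambda_{N-1}(a^{(1)})\le\lambda_{N-1}(a^{(2)})$; (ii) if $b_{22}\neq0$ and $a^{(1)}<a^{(2)}\le|z|^2/b_{22}+1/f_0<a^{(3)}<a^{(4)}$: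 for each $0\le n\le N-2$, $\lambda_n(a^{(3)})\le\lambda_n(a^{(4)})\le\lambda_n(\mathbf S_7)\le\lambda_n(a^{(1)})\le\lambda_n(a^{(2)})\le\lambda_{n+1}(a^{(3)})$, and $\lambda_{N-1}(a^{(3)})\le\lambda_{N-1}(a^{(4)})\le\lambda_{N-1}(\mathbf S_7)\le\lambda_{N-1}(a^{(1)})$; in addition $\lambda_{N-1}(a^{(1)})\le\lambda_{N-1}(a^{(2)})$ if $a^{(2)}<|z|^2/b_{22}+1/f_0$; (iii) if $a_{12}-1/f_0=0$ and $b^{(1)}<b^{(2)}$: for each $0\le n\le N-2$, $\lambda_n(b^{(1)})\le\lambda_n(b^{(2)})\le\lambda_n(\mathbf S_8)\le\lambda_{n+1}(b^{(1)})$, and $\lambda_{N-1}(b^{(1)})\le\lambda_{N-1}(b^{(2)})$; (iv) if $a_{12}-1/f_0\neq0$ and $b^{(1)}<b^{(2)}\le|z|^2/(a_{12}-1/f_0)<b^{(3)}<b^{(4)}$: for each $0\le n\le N-2$, $\lambda_n(b^{(3)})\le\lambda_n(b^{(4)})\le\lambda_n(\mathbf S_8)\le\lambda_n(b^{(1)})\le\lambda_n(b^{(2)})\le\lambda_{n+1}(b^{(3)})$, and $\lambda_{N-1}(b^{(3)})\le\lambda_{N-1}(b^{(4)})\le\lambda_{N-1}(\mathbf S_8)\le\lambda_{N-1}(b^{(1)})$; in addition $\lambda_{N-1}(b^{(1)})\le\lambda_{N-1}(b^{(2)})$ if $b^{(2)}<|z|^2/(a_{12}-1/f_0)$.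
   Context: Let $N\ge2$ be an integer. An equation is given by real sequences $f=\{f_n\}_{n=0}^N$, $q=\{q_n\}_{n=1}^N$, $w=\{w_n\}_{n=1}^N$ with $f_n\neq0$, $w_n>0$; it is $-\nabla(f_n\Delta y_n)+q_ny_n=\lambda w_ny_n$, $1\le n\le N$, for $y=\{y_n\}_{n=0}^{N+1}$, $\Delta y_n=y_{n+1}-y_n$, $\nabla y_n=y_n-y_{n-1}$. A boundary condition with $2\times4$ coefficient matrix $(A,B)$ (rank 2) is $A(y_0,f_0\Delta y_0)^T+B(y_N,f_N\Delta y_N)^T=0$; matrices differing by left multiplication by an invertible $2\times2$ complex matrix give the same condition. Eigenvalues ($\lambda$ with a nontrivial solution) of a self-adjoint problem are real; multiplicity = dimension of the solution space (equal to the multiplicity as a zero of the characteristic polynomial); counted with multiplicity they are ordered $\lambda_0\le\lambda_1\le\cdots$, and ''exactly $k$ eigenvalues'' counts multiplicity. *)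

(* Defs.v *)
(* mathcomp algebra + real_closed's complex numbers R[i]. *)
From HB Require Import structures.
From mathcomp Require Import all_boot all_order all_algebra.
From mathcomp Require Export complex.
Set Implicit Arguments. Unset Strict Implicit. Unset Printing Implicit Defensive.
Import Order.TTheory GRing.Theory Num.Theory.
Local Open Scope ring_scope.
Local Open Scope complex_scope.

Section SLDefs.
Variable R : rcfType.
Local Notation C := R[i].

(* real -> complex embedding *)
Definition rC (x : R) : C := x%:C.

(* |z|^2 as a real number *)
Definition normsq (z : C) : R := (complex.Re z) ^+ 2 + (complex.Im z) ^+ 2.

(* A boundary condition A (y_0, f_0 Δy_0)^T + B (y_N, f_N Δy_N)^T = 0,
   given by the 2x4 coefficient matrix (A | B). *)
Record bcond := BCond { bcA : 'M[C]_2 ; bcB : 'M[C]_2 }.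

Definition i0 : 'I_2 := ord0.
Definition i1 : 'I_2 := ord_max.

(* the 2x2 matrix [[a, b], [c, d]] *)
Definition mx2 (a b c d : C) : 'M[C]_2 :=
  \matrix_(i, j) if i == i0 then (if j == i0 then a else b)
                 else (if j == i0 then c else d).

(* j-th component (0 <= j < N+2) of the (linear in y) residual of the problem
   for y = (y_0, ..., y_{N+1}):
   for j < N : the equation at n = j+1,
     -∇(f_n Δy_n) + q_n y_n - λ w_n y_n ;
   for j = N, N+1 : rows 1, 2 of the boundary condition. *)
Definition residual (N : nat) (f q w : nat -> R) (P : bcond) (lam : C)
    (y : nat -> C) (j : nat) : C :=
  if (j < N)%N then
    let n := j.+1 in
    - (rC (f n) * (y n.+1 - y n) - rC (f n.-1) * (y n - y n.-1))
      + rC (q n) * y n - lam * rC (w n) * y n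
  else
    let r : 'I_2 := inord (j - N) in
    bcA P r i0 * y 0%N + bcA P r i1 * (rC (f 0%N) * (y 1%N - y 0%N))
    + bcB P r i0 * y N + bcB P r i1 * (rC (f N) * (y N.+1 - y N)).

(* Matrix of the linear map y |-> residual (rows: unknowns y_0..y_{N+1},
   columns: the N+2 equations); a row vector u solves the problem iff
   u *m sl_mx = 0, so the solution space is kermx sl_mx. *)
Definition sl_mx (N : nat) (f q w : nat -> R) (P : bcond) (lam : C)
  : 'M[C]_(N.+2) :=
  \matrix_(i, j) residual N f q w P lam (fun m => (m == i :> nat)%:R) j.

(* multiplicity = dimension of the solution space (0 if lam is not an eigenvalue) *)
Definition mult (N : nat) (f q w : nat -> R) (P : bcond) (lam : C) : nat :=
  \rank (kermx (sl_mx N f q w P lam)).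

(* s is the nondecreasing list of all eigenvalues, repeated according to
   multiplicity (in particular all eigenvalues are real and finitely many):
   then lambda_n = nth 0 s n, and the number of eigenvalues is size s. *)
Definition is_spectrum (N : nat) (f q w : nat -> R) (P : bcond) (s : seq R) :=
  sorted <=%R s /\
  forall lam : C, mult N f q w P lam = count (fun x => rC x == lam) s.

(* the boundary conditions of the theorem *)
Definition bcA_ab (z : C) (a12 b22 : R) : bcond :=
  BCond (mx2 1 (rC a12) 0 z) (mx2 0 (z^*) (-1) (rC b22)).
Definition bcS7 (b22 : R) : bcond :=
  BCond (mx2 0 1 0 0) (mx2 0 0 (-1) (rC b22)).
Definition bcS8 (a12 : R) : bcond :=
  BCond (mx2 1 (rC a12) 0 0) (mx2 0 0 0 1).

End SLDefs.

(* Main.v *)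
Require Import Defs.
From HB Require Import structures.
From mathcomp Require Import all_boot all_order all_algebra.
From mathcomp Require Import complex spectral sesquilinear ring lra zify.
Set Implicit Arguments. Unset Strict Implicit. Unset Printing Implicit Defensive.
Import Order.TTheory GRing.Theory Num.Theory.
Local Open Scope ring_scope.
Local Open Scope sesquilinear_scope.
Local Open Scope complex_scope.

(** With the unknowns Y_n = sqrt(w_n) y_n (1 <= n <= N), s = f_0 Δy_0 and
    t = - f_N Δy_N, every problem of the theorem becomes x K(lam) = 0 for a
    Hermitian pencil K(lam) = [[L - lam, E], [E^*, M]], in which L is a Jacobi
    matrix and only the small block M carries the boundary condition:
    M = [[al, -z], [-z^*, b]] with al = a12 - 1/f_0 for A(a12, b22), while S7 and
    S8 are the compressions of K(lam) to s = 0 and to t = 0.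

    If M has n_- negative eigenvalues and an r-dimensional kernel, the problem has
    N - r eigenvalues, and the negative index of K(lam) is the number of
    eigenvalues below lam plus the constant r + n_-.  Raising al or b raises
    the form K(lam), so its negative index decreases; a compression to
    codimension one lowers it by at most one.  Both facts bound the numbers of
    eigenvalues below lam against each other, the offsets r + n_- are read off a
    diagonalisation of M, and all the interlacing inequalities follow. *)

(** * Negative index of a Hermitian pencil *)

Section Inertia.
Variable C : numClosedFieldType.

(** * The conjugate transpose *)

Lemma adjM m n p (A : 'M[C]_(m, n)) (B : 'M_(n, p)) :
  (A *m B)^t* = B^t* *m A^t*.
Proof. by rewrite trmx_mul map_mxM. Qed.

Lemma adjD m n (A B : 'M[C]_(m, n)) : (A + B)^t* = A^t* + B^t*.
Proof. by rewrite linearD /= map_mxD. Qed.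

Lemma adjN m n (A : 'M[C]_(m, n)) : (- A)^t* = - A^t*.
Proof. by rewrite linearN /= map_mxN. Qed.

Lemma adj0 m n : (0 : 'M[C]_(m, n))^t* = 0.
Proof. by rewrite trmx0 map_mx0. Qed.

Lemma adj_row m n1 n2 (A : 'M[C]_(m, n1)) (B : 'M_(m, n2)) :
  (row_mx A B)^t* = col_mx (A^t*) (B^t*).
Proof. by rewrite tr_row_mx map_col_mx. Qed.

Lemma adj_col m1 m2 n (A : 'M[C]_(m1, n)) (B : 'M_(m2, n)) :
  (col_mx A B)^t* = row_mx (A^t*) (B^t*).
Proof. by rewrite tr_col_mx map_row_mx. Qed.

Lemma adj_scalar n (a : C) : (a%:M : 'M_n)^t* = (a^*)%:M.
Proof. by rewrite tr_scalar_mx map_scalar_mx. Qed.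

Lemma adj_diag n (d : 'rV[C]_n) : (forall i, d 0 i \is Num.real) ->
  (diag_mx d)^t* = diag_mx d.
Proof.
move=> dr; rewrite tr_diag_mx map_diag_mx; congr diag_mx; apply/rowP => i.
by rewrite mxE; apply: CrealP; apply: dr.
Qed.

Lemma mul_adj_eq0 m n p (A : 'M[C]_(m, n)) (B : 'M_(n, p)) :
  A *m B = 0 -> B^t* *m A^t* = 0.
Proof. by rewrite -adjM => ->; apply: adj0. Qed.

Lemma rV_neq0 n (a : 'rV[C]_n) : a != 0 -> exists i, a 0 i != 0.
Proof.
move=> aN0; apply/existsP; apply: contraNT aN0.
rewrite negb_exists => /forallP a0; apply/eqP/rowP => i; rewrite mxE.
by apply/eqP; rewrite -[_ == _]negbK a0.
Qed.

(** * Hermitian forms with their negative and semidefinite subspaces *)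

Definition hform n (H : 'M[C]_n) (x : 'rV[C]_n) : C := (x *m H *m x^t*) 0 0.

Lemma hformM n m (H : 'M[C]_n) (U : 'M_(m, n)) (a : 'rV_m) :
  hform H (a *m U) = hform (U *m H *m U^t*) a.
Proof. by rewrite /hform adjM !mulmxA. Qed.

Definition neg_sub n m (H : 'M[C]_n) (U : 'M_(m, n)) :=
  forall a : 'rV_m, a != 0 -> hform H (a *m U) < 0.

Definition psd_sub n m (H : 'M[C]_n) (U : 'M_(m, n)) :=
  forall a : 'rV_m, 0 <= hform H (a *m U).

(** Strict negativity forces the rows of [U] to be independent, since a vanishing combination would
    have value 0; in [psd_dim] freeness is a separate demand. *)
Definition neg_dim n (H : 'M[C]_n) d := exists U : 'M_(d, n), neg_sub H U.

Definition psd_dim n (H : 'M[C]_n) d :=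
  exists2 U : 'M_(d, n), row_free U & psd_sub H U.

Lemma hform0 n (H : 'M[C]_n) : hform H 0 = 0.
Proof. by rewrite /hform !mul0mx mxE. Qed.

Lemma hformN n (H : 'M[C]_n) x : hform H (- x) = hform H x.
Proof. by rewrite /hform adjN mulNmx mulmxN mulNmx opprK. Qed.

Lemma hform_diag n (d x : 'rV[C]_n) :
  hform (diag_mx d) x = \sum_i `|x 0 i| ^+ 2 * d 0 i.
Proof.
rewrite /hform mul_mx_diag mxE; apply: eq_bigr => i _.
by rewrite !mxE normCK mulrAC.
Qed.

(** Pythagoras: the cross terms vanish because the two row spaces are orthogonal for the form. *)
Lemma hform_col n m1 m2 (H : 'M[C]_n) (U1 : 'M_(m1, n)) (U2 : 'M_(m2, n)) a1 a2 :
  H^t* = H -> U1 *m H *m U2^t* = 0 ->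
  hform H (row_mx a1 a2 *m col_mx U1 U2)
  = hform H (a1 *m U1) + hform H (a2 *m U2).
Proof.
move=> Hh H12; have H21 : U2 *m H *m U1^t* = 0.
  by rewrite -[RHS](mul_adj_eq0 H12) adjM trmxCK Hh mulmxA.
rewrite /hform mul_row_col adjD !mulmxDl !mulmxDr.
have -> : a1 *m U1 *m H *m (a2 *m U2)^t* = 0.
  by rewrite adjM !mulmxA -(mulmxA a1) -(mulmxA a1) H12 mulmx0 mul0mx.
have -> : a2 *m U2 *m H *m (a1 *m U1)^t* = 0.
  by rewrite adjM !mulmxA -(mulmxA a2) -(mulmxA a2) H21 mulmx0 mul0mx.
by rewrite addr0 add0r mxE.
Qed.

Lemma neg_sub_col n m1 m2 (H : 'M[C]_n) (U1 : 'M_(m1, n)) (U2 : 'M_(m2, n)) :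
  H^t* = H -> U1 *m H *m U2^t* = 0 ->
  neg_sub H U1 -> neg_sub H U2 -> neg_sub H (col_mx U1 U2).
Proof.
move=> Hh H12 N1 N2 a; rewrite -[a]hsubmxK hform_col //.
move: (lsubmx a) (rsubmx a) => a1 a2.
have [->|a1N0] := eqVneq a1 0.
  rewrite mul0mx hform0 add0r => a2N0; apply: N2.
  by apply: contraNneq a2N0 => ->; rewrite row_mx0.
move=> _; have [->|a2N0] := eqVneq a2 0.
  by rewrite mul0mx hform0 addr0; apply: N1.
by rewrite -[ltRHS](addr0 0) ltrD ?N1 ?N2.
Qed.

Lemma psd_sub_col n m1 m2 (H : 'M[C]_n) (U1 : 'M_(m1, n)) (U2 : 'M_(m2, n)) :
  H^t* = H -> U1 *m H *m U2^t* = 0 ->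
  psd_sub H U1 -> psd_sub H U2 -> psd_sub H (col_mx U1 U2).
Proof.
by move=> Hh H12 N1 N2 a; rewrite -[a]hsubmxK hform_col // addr_ge0 ?N1 ?N2.
Qed.

(** A negative and a semidefinite subspace meet only in 0. Every later comparison of negative
    indices goes through this bound. *)
Lemma neg_psd_dim_le n (H : 'M[C]_n) d e :
  neg_dim H d -> psd_dim H e -> (d + e <= n)%N.
Proof.
move=> [U nU] [V fV pV]; rewrite leqNgt; apply/negP => ltn.
have : kermx (col_mx U V) != 0.
  rewrite -mxrank_eq0 mxrank_ker subn_eq0 -ltnNge.
  by apply: leq_ltn_trans ltn; apply: rank_leq_col.
case/rowV0Pn => a /sub_kermxP; rewrite -[a]hsubmxK mul_row_col.
move: (lsubmx a) (rsubmx a) => a1 a2 /eqP; rewrite addr_eq0 => /eqP E aN0.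
have [a10|a1N0] := eqVneq a1 0.
  move/eqP: E; rewrite a10 mul0mx eq_sym oppr_eq0 mulmx_free_eq0 // => /eqP a20.
  by rewrite a10 a20 row_mx0 eqxx in aN0.
by have := nU _ a1N0; rewrite E hformN => /(le_lt_trans (pV a2)); rewrite ltxx.
Qed.

Lemma neg_dim_compr n m (H : 'M[C]_n) (J : 'M_(m, n)) d :
  neg_dim (J *m H *m J^t*) d -> neg_dim H d.
Proof.
by case=> U nU; exists (U *m J) => a aN0; rewrite mulmxA hformM nU.
Qed.

Lemma psd_dim_compr n m (H : 'M[C]_n) (J : 'M_(m, n)) d : row_free J ->
  psd_dim (J *m H *m J^t*) d -> psd_dim H d.
Proof.
move=> fJ [U fU nU]; exists (U *m J); first by rewrite /row_free mxrankMfree.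
by move=> a; rewrite mulmxA hformM nU.
Qed.

Lemma neg_dim_le n (H1 H2 : 'M[C]_n) d :
  (forall x, hform H1 x <= hform H2 x) -> neg_dim H2 d -> neg_dim H1 d.
Proof. by move=> le [U nU]; exists U => a /nU; apply: le_lt_trans. Qed.

Lemma row_free_rowsub m n p (T : 'M[C]_(m, n)) (f : 'I_p -> 'I_m) :
  injective f -> row_free T -> row_free (rowsub f T).
Proof.
move=> fI fT; rewrite rowsubE /row_free mxrankMfree // -/(row_free _).
apply/row_freeP; exists (\matrix_(i, j) (i == f j)%:R).
apply/matrixP => i j; rewrite !mxE (bigD1 (f i)) //= big1 => [|k kN].
  by rewrite !mxE eqxx mul1r addr0 (inj_eq fI).
by rewrite !mxE eq_sym (negPf kN) mul0r.
Qed.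

Lemma sub_rowsub m n (A : {set 'I_m}) (b : 'rV[C]_m) (X : 'M_(m, n)) :
  (forall i, i \notin A -> b 0 i = 0) ->
  (b *m X <= rowsub (@enum_val _ (mem A)) X)%MS.
Proof.
move=> b0; rewrite mulmx_sum_row summx_sub // => i _.
have [iA|/b0 ->] := boolP (i \in A); last by rewrite scale0r sub0mx.
apply: scalemx_sub.
have -> : row i X = row (enum_rank_in iA i) (rowsub enum_val X).
  by apply/rowP => j; rewrite !mxE enum_rankK_in.
exact: row_sub.
Qed.

Lemma rowsub_diag0 m (A : {set 'I_m}) (d : 'rV[C]_m) :
  {in A, forall i, d 0 i = 0} ->
  rowsub (@enum_val _ (mem A)) 1%:M *m diag_mx d = 0.
Proof.
move=> d0; apply/matrixP => i j; rewrite mul_mx_diag !mxE.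
have [<-|_] := eqVneq (enum_val i) j; last by rewrite mul0r.
by rewrite d0 ?mulr0 //; apply: enum_valP.
Qed.

Lemma rowsub_congr n m p (H : 'M[C]_n) (T : 'M_(m, n)) (f : 'I_p -> 'I_m)
    (d : 'rV_m) : injective f -> T *m H *m T^t* = diag_mx d ->
  rowsub f T *m H *m (rowsub f T)^t* = diag_mx (colsub f d).
Proof.
move=> fI E; rewrite rowsubE adjM !mulmxA -(mulmxA _ T) -(mulmxA _ (T *m H)) E.
apply/matrixP => i j; rewrite !mxE (bigD1 (f j)) //= big1 => [|k kN].
  rewrite !mxE (bigD1 (f i)) //= big1 => [|k kN].
    by rewrite !mxE !eqxx mul1r rmorph1 mulr1 !addr0 (inj_eq fI).
  by rewrite !mxE eq_sym (negPf kN) mul0r.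
by rewrite !mxE eq_sym (negPf kN) rmorph0 mulr0.
Qed.

Lemma neg_sub_diag n m (H : 'M[C]_n) (T : 'M_(m, n)) (d : 'rV_m)
    (A : {set 'I_m}) : T *m H *m T^t* = diag_mx d ->
  {in A, forall i, d 0 i < 0} -> neg_sub H (rowsub (@enum_val _ (mem A)) T).
Proof.
move=> E Ad a aN0; rewrite hformM (rowsub_congr _ E); last exact: enum_val_inj.
rewrite hform_diag.
have [i ai] := rV_neq0 aN0.
have dlt j : colsub (enum_val (A := mem A)) d 0 j < 0.
  by rewrite mxE; apply: Ad; apply: enum_valP.
rewrite (bigD1 i) //= -[ltRHS](addr0 0) ltr_leD //.
  by rewrite pmulr_rlt0 ?dlt // exprn_gt0 // normr_gt0.
by apply: sumr_le0 => j _; rewrite mulr_ge0_le0 ?exprn_ge0 // ltW ?dlt.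
Qed.

Lemma psd_sub_diag n m (H : 'M[C]_n) (T : 'M_(m, n)) (d : 'rV_m)
    (A : {set 'I_m}) : T *m H *m T^t* = diag_mx d ->
  {in A, forall i, 0 <= d 0 i} -> psd_sub H (rowsub (@enum_val _ (mem A)) T).
Proof.
move=> E Ad a; rewrite hformM (rowsub_congr _ E); last exact: enum_val_inj.
rewrite hform_diag; apply: sumr_ge0 => j _; rewrite mulr_ge0 ?exprn_ge0 //.
by rewrite mxE; apply: Ad; apply: enum_valP.
Qed.

(** The rows of [G] come from Gram-Schmidt on the kernel of [g^t*]; completeness holds because a
    one-sided inverse of a square matrix is two-sided. *)
Lemma ortho_frame r N (g : 'M[C]_(r, N)) : g *m g^t* = 1%:M ->
  exists n (G : 'M_(n, N)), [/\ (n + r)%N = N, G *m G^t* = 1%:M,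
     G *m g^t* = 0 & G^t* *m G + g^t* *m g = 1%:M].
Proof.
move=> gg; set K := kermx (g^t*); set G1 := row_base K.
have rg : \rank g = r by apply: mxrank_unitary; apply/unitarymxP.
have rKr : (\rank K + r)%N = N.
  rewrite /K mxrank_ker mxrank_map mxrank_tr rg subnK // -rg.
  exact: rank_leq_col.
have rK : (\rank K <= N)%N by apply: rank_leq_col.
exists (\rank K), (schmidt G1).
have GG : schmidt G1 *m (schmidt G1)^t* = 1%:M.
  by apply/unitarymxP; apply: schmidt_unitarymx.
have Gg : schmidt G1 *m g^t* = 0.
  apply/sub_kermxP; rewrite -/K.
  have /eqmxP/andP [s _] := eqmx_schmidt_free (row_base_free K).
  by rewrite (submx_trans s) // eq_row_base.
split=> //.
move: (schmidt G1) GG Gg; clear G1.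
move: (\rank K) rKr; clear K rK => n nrN G GG Gg.
(* Replacing [N] by [n + r] makes [col_mx G g] square, as [mulmx1C] requires. *)
case: N / nrN g gg rg G GG Gg => g gg rg G GG Gg.
have gG : g *m G^t* = 0 by rewrite -[RHS](mul_adj_eq0 Gg) trmxCK.
have /mulmx1C : col_mx G g *m (col_mx G g)^t* = 1%:M.
  by rewrite adj_col mul_col_row GG gg Gg gG scalar_mx_block.
by rewrite adj_col mul_row_col.
Qed.

(** * Kernel and inertia of the bordered pencil *)

Section Pencil.
Variables (N k : nat) (L : 'M[C]_N) (E : 'M[C]_(N, k)) (M : 'M[C]_k).
Hypotheses (Lh : L^t* = L) (Mh : M^t* = M) (Ef : row_free (E^t*)).

(** A kernel vector is a pair (Y, p) solving Y L + p E^* = lam Y and Y E + p M = 0: an eigenvalue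
    equation with boundary equations free of [lam]. *)
Definition pencil (lam : C) : 'M[C]_(N + k) :=
  block_mx (L - lam%:M) E (E^t*) M.

Lemma pencil_herm lam : lam \is Num.real -> (pencil lam)^t* = pencil lam.
Proof.
move=> lr; rewrite /pencil tr_block_mx map_block_mx trmxCK Mh; congr block_mx.
by rewrite adjD Lh adjN adj_scalar; move/CrealP: lr => ->.
Qed.

(** The kernel basis is normalised through its image under [E^t*], which stays independent because
    [E^t*] is free; the Y-parts of eigenvectors are orthogonal to this image. *)
Lemma ker_frame : exists V : 'M_(\rank (kermx M), k),
  V *m M = 0 /\ (V *m E^t*) *m (V *m E^t*)^t* = 1%:M.
Proof.
set V1 := row_base (kermx M).
have V1M : V1 *m M = 0 by apply/sub_kermxP; rewrite eq_row_base.
have gf : row_free (V1 *m E^t*).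
  by rewrite /row_free mxrankMfree // -/(row_free V1) row_base_free.
have rN : (\rank (kermx M) <= N)%N.
  by move/eqP: gf => <-; apply: rank_leq_col.
(* [Z] records the Gram-Schmidt operations, so that they can be applied to the kernel basis
   itself. *)
have := eqmx_schmidt_free gf; case/eqmxP/andP => /submxP [Z ZE] _.
exists (Z *m V1); split; first by rewrite -mulmxA V1M mulmx0.
by rewrite -[Z *m V1 *m _]mulmxA -ZE; apply/unitarymxP; apply: schmidt_unitarymx.
Qed.

(** For Hermitian [M] the row space is the orthogonal complement of the kernel: one inclusion, then
    equality of dimensions. *)
Lemma sub_ker_adj n (V : 'M_(\rank (kermx M), k)) (A : 'M_(n, k)) :
  V *m M = 0 -> row_free V -> A *m V^t* = 0 -> (A <= M)%MS.
Proof.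
move=> VM Vf AV; have MV : M *m V^t* = 0.
  by rewrite -[RHS](mul_adj_eq0 VM) Mh.
have /sub_kermxP sMV := MV; have /sub_kermxP sAV := AV.
apply: submx_trans sAV _; rewrite -(geq_leqif (mxrank_leqif_sup sMV)).
rewrite mxrank_ker mxrank_map mxrank_tr; move/eqP: Vf => ->.
by rewrite mxrank_ker subKn // rank_leq_col.
Qed.

(* The rows of [row_mx G P] are the eigenvectors: the eigenvalue equation forces
   Y to be orthogonal to g = V E^*, and the component of P along V is the
   Lagrange multiplier of this constraint. *)
Lemma eigen_frame (V : 'M_(\rank (kermx M), k)) (g := V *m E^t*) :
  V *m M = 0 -> g *m g^t* = 1%:M ->
  exists n (G : 'M_(n, N)) (P : 'M_(n, k)) (D : 'rV_n),
    [/\ (n + \rank (kermx M))%N = N, (forall i, D 0 i \is Num.real),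
        [/\ G *m G^t* = 1%:M, G *m g^t* = 0 & G^t* *m G + g^t* *m g = 1%:M],
        G *m L + P *m E^t* = diag_mx D *m G & G *m E + P *m M = 0].
Proof.
move=> VM gg; have [n [G [nr GG Gg GGgg]]] := ortho_frame gg.
have gf : row_free g by apply/row_freeP; exists (g^t*).
have Vf : row_free V.
  rewrite /row_free eqn_leq rank_leq_row /=; move/eqP: gf => {1}<-.
  exact: mxrankM_maxl.
(* The rows of G E are orthogonal to the kernel of [M], hence lie in its row space; this makes the
   boundary equation solvable for [P1]. *)
have /(sub_ker_adj VM Vf) /submxP [P0 EP0] : (G *m E) *m V^t* = 0.
  by rewrite -mulmxA; move: Gg; rewrite /g adjM trmxCK.
have [P1 GEP] : exists P1, G *m E + P1 *m M = 0.
  by exists (- P0); rewrite EP0 mulNmx subrr.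
(* Moving [P1] along [V], which the boundary equation does not see, removes the component of [B]
   along [g]; what remains is [T *m G]. *)
pose B := G *m L + P1 *m E^t*.
pose P := P1 - B *m g^t* *m V; pose T := B *m G^t*.
have PM : G *m E + P *m M = 0.
  by rewrite /P mulmxDl mulNmx -(mulmxA _ V M) VM mulmx0 subr0.
have GLP : G *m L + P *m E^t* = T *m G.
  rewrite /P mulmxDl mulNmx addrA -/B -(mulmxA _ V) -/g.
  rewrite -{1}[B]mulmx1 -GGgg mulmxDr -[B *m g^t* *m g]mulmxA addrK.
  by rewrite mulmxA.
(* The boundary equation rewrites [T] as G L G^* - P1 M P1^*, so the spectral theorem applies. *)
have Th : T^t* = T.
  have EG : E^t* *m G^t* = - (M *m P1^t*).
    have := congr1 (fun A => A^t*) GEP; rewrite adjD !adjM adj0 Mh => /eqP.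
    by rewrite addr_eq0 => /eqP.
  have TE : T = G *m L *m G^t* - P1 *m M *m P1^t*.
    by rewrite /T /B mulmxDl -(mulmxA P1) EG mulmxN mulmxA.
  by rewrite TE adjD adjN !adjM !trmxCK Lh Mh !mulmxA.
have Thm : T \is hermsymmx.
  by apply/is_hermitianmxP; rewrite expr0 scale1r Th.
have /orthomx_spectralP ET := hermitian_normalmx Thm.
set Q := spectralmx T; set D := spectral_diag T.
have Qu : Q \is unitarymx by apply: spectral_unitarymx.
have QQ : Q *m Q^t* = 1%:M by apply/unitarymxP.
have QQ' : Q^t* *m Q = 1%:M by apply: mulmx1C.
have QT : Q *m T = diag_mx D *m Q.
  by rewrite {1}ET -/Q -/D mulmxA mulmxA mulmxV ?mul1mx // unitarymx_unit.
exists n, (Q *m G), (Q *m P), D; split=> //.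
- by move=> i; have /mxOverP := hermitian_spectral_diag_real Thm; apply.
- split.
  + by rewrite adjM mulmxA -(mulmxA Q) GG mulmx1.
  + by rewrite -mulmxA Gg mulmx0.
  + by rewrite (adjM Q G) mulmxA -(mulmxA _ _ Q) QQ' mulmx1.
- by rewrite -!mulmxA -mulmxDr GLP mulmxA QT mulmxA.
- by rewrite -!mulmxA -mulmxDr PM mulmx0.
Qed.

Section Frame.
Variables (V : 'M[C]_(\rank (kermx M), k)) (n : nat).
Let g : 'M_(_, N) := V *m E^t*.
Variables (G : 'M[C]_(n, N)) (P : 'M[C]_(n, k)) (D : 'rV[C]_n).
Hypotheses (VM : V *m M = 0) (gg : g *m g^t* = 1%:M).
Hypothesis Dr : forall i, D 0 i \is Num.real.
Hypotheses (GG : G *m G^t* = 1%:M) (Gg : G *m g^t* = 0).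
Hypothesis GGgg : G^t* *m G + g^t* *m g = 1%:M.
Hypothesis GLP : G *m L + P *m E^t* = diag_mx D *m G.
Hypothesis GEP : G *m E + P *m M = 0.

Let X := row_mx G P.

(** The vanishing second block makes the frame orthogonal, for the pencil, to every row of the form
    (0, U). *)
Lemma frame_pencil lam :
  X *m pencil lam = row_mx (diag_mx (D - const_mx lam) *m G) 0.
Proof.
rewrite /X /pencil mul_row_block GEP mulmxBr addrAC GLP.
by rewrite raddfB /= mulmxBl diag_const_mx scalar_mxC.
Qed.

Lemma frame_free : row_free X.
Proof.
apply/row_freeP; exists (col_mx (G^t*) 0).
by rewrite mul_row_col GG mulmx0 addr0.
Qed.

Lemma frame_congr lam :
  X *m pencil lam *m X^t* = diag_mx (D - const_mx lam).
Proof.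
rewrite frame_pencil /X adj_row mul_row_col mul0mx addr0.
by rewrite -mulmxA GG mulmx1.
Qed.

(** Subtracting [b *m X] from a kernel vector leaves a kernel vector whose first part lies in the
    span of [g]. The boundary equation tested against [V] kills that part, and freeness of [E^t*]
    kills the second. *)
Lemma ker_pencil_frame lam (x : 'rV_(N + k)) : x *m pencil lam = 0 ->
  exists2 b : 'rV_n, x = b *m X & forall i, D 0 i != lam -> b 0 i = 0.
Proof.
move: (frame_pencil lam); rewrite -[x]hsubmxK.
move: (lsubmx x) (rsubmx x) => Y p XK xK.
have:= xK; rewrite /pencil mul_row_block.
rewrite -[0 in X in X -> _]row_mx0 => /eq_row_mx [xK1 xK2].
pose b := Y *m G^t*.
have LG : L *m G^t* = G^t* *m diag_mx D - E *m P^t*.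
  have := congr1 (fun A => A^t*) GLP.
  by rewrite adjD !adjM Lh trmxCK adj_diag // => <-; rewrite addrK.
have EG : E^t* *m G^t* = - (M *m P^t*).
  have := congr1 (fun A => A^t*) GEP; rewrite adjD !adjM adj0 Mh => /eqP.
  by rewrite addr_eq0 => /eqP.
(* Adding the first kernel equation times G^* and the second times P^* eliminates [L], [E] and
   [M]. *)
have bD : b *m diag_mx (D - const_mx lam) = 0.
  have -> : b *m diag_mx (D - const_mx lam)
      = (Y *m (L - lam%:M) + p *m E^t*) *m G^t* + (Y *m E + p *m M) *m P^t*.
    rewrite mulmxDl -!mulmxA EG mulmxBl LG mulmxN mulmxDl -!mulmxA.
    rewrite raddfB /= diag_const_mx !mulmxBr mul_scalar_mx mul_mx_scalar.
    rewrite -scalemxAr mulmxA -/b addrACA addNr addr0.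
    by rewrite addrAC subrK.
  by rewrite xK1 xK2 !mul0mx addr0.
have bX : b *m X *m pencil lam = 0.
  by rewrite -mulmxA XK mul_mx_row mulmx0 mulmxA bD mul0mx row_mx0.
have b0 i : D 0 i != lam -> b 0 i = 0.
  move=> Dl; have := congr1 (fun A : 'M_(_, _) => A 0 i) bD.
  rewrite mul_mx_diag !mxE => /eqP; rewrite mulf_eq0 subr_eq0 (negPf Dl) orbF.
  by move/eqP.
exists b => //.
pose Y' := Y - b *m G; pose p' := p - b *m P.
have xE : row_mx Y p - b *m X = row_mx Y' p'.
  by rewrite /X mul_mx_row opp_row_mx add_row_mx.
have : row_mx Y' p' *m pencil lam = 0 by rewrite -xE mulmxBl xK bX subr0.
rewrite /pencil mul_row_block -[0 in X in X -> _]row_mx0 => /eq_row_mx [K1 K2].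
have Y'E : Y' = Y *m g^t* *m g.
  by rewrite /Y' /b -mulmxA -{1}[Y]mulmx1 -GGgg mulmxDr addrAC subrr add0r mulmxA.
have MV : M *m V^t* = 0 by rewrite -[RHS](mul_adj_eq0 VM) Mh.
have Y'0 : Y' = 0.
  have := congr1 (fun A => A *m V^t*) K2.
  rewrite mul0mx mulmxDl -(mulmxA Y') -(mulmxA p') MV mulmx0 addr0.
  have -> : E *m V^t* = g^t* by rewrite /g adjM trmxCK.
  by rewrite Y'E -(mulmxA _ g) gg mulmx1 => ->; rewrite mul0mx.
have p'0 : p' = 0.
  by move/eqP: K1; rewrite Y'0 mul0mx add0r mulmx_free_eq0 // => /eqP.
by apply/eqP; rewrite -subr_eq0 xE Y'0 p'0 row_mx0.
Qed.

Lemma rank_ker_pencil lam :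
  \rank (kermx (pencil lam)) = #|[set i | D 0 i == lam]|.
Proof.
set A := [set i | _]; set S := rowsub (@enum_val _ (mem A)) X.
have Sf : row_free S by apply: row_free_rowsub frame_free; apply: enum_val_inj.
move/eqP: (Sf) => <-; apply: eqmx_rank; apply/andP; split.
  apply/rV_subP => x /sub_kermxP /ker_pencil_frame [b -> b0].
  by apply: sub_rowsub => i; rewrite inE => /b0.
apply/sub_kermxP; rewrite /S rowsubE -mulmxA frame_pencil mul_mx_row mulmx0.
rewrite mulmxA rowsub_diag0 ?mul0mx ?row_mx0 // => i.
by rewrite inE => /eqP Di; rewrite !mxE Di subrr.
Qed.

(** The frame rows with eigenvalue at least [lam] and the rows (0, U) are orthogonal for the pencil,
    and jointly independent because [G] is free. *)
Lemma psd_dim_pencil lam d : lam \is Num.real -> psd_dim M d ->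
  psd_dim (pencil lam) (#|[set i | lam <= D 0 i]| + d).
Proof.
move=> lr [U Uf Up]; set A := [set i | _].
set S := rowsub (@enum_val _ (mem A)) X.
exists (col_mx S (row_mx 0 U)).
  rewrite -kermx_eq0; apply/rowV0P => a /sub_kermxP; rewrite -[a]hsubmxK.
  move: (lsubmx a) (rsubmx a) => a1 a2.
  rewrite mul_row_col => E0; have a10 : a1 *m rowsub (@enum_val _ (mem A)) G = 0.
    have := congr1 (fun A : 'rV_(N + k) => lsubmx A) E0.
    rewrite linearD /= linear0 -!mulmx_lsub row_mxKl mulmx0 addr0.
    by rewrite /S rowsubE -mulmx_lsub row_mxKl -rowsubE.
  have fG : row_free G by apply/row_freeP; exists (G^t*).
  have a1z : a1 = 0.
    have fS := row_free_rowsub (@enum_val_inj _ (mem A)) fG.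
    by apply/eqP; rewrite -(mulmx_free_eq0 a1 fS) a10.
  move: E0; rewrite a1z mul0mx add0r mul_mx_row mulmx0 -row_mx0.
  case/eq_row_mx => _ /eqP; rewrite mulmx_free_eq0 // => /eqP ->.
  by rewrite row_mx0.
apply: psd_sub_col; first exact: pencil_herm.
- rewrite /S rowsubE -mulmxA -mulmxA [X *m _]mulmxA frame_pencil adj_row.
  by rewrite mul_row_col adj0 mulmx0 mul0mx addr0 mulmx0.
- by apply: psd_sub_diag (frame_congr lam) _ => i; rewrite inE !mxE subr_ge0.
- move=> a; have := Up a; rewrite !hformM; congr (0 <= hform _ _).
  rewrite /pencil mul_row_block adj_row mul_row_col adj0 mulmx0 !mul0mx !add0r.
  by [].
Qed.

(** For v in the kernel of [M], the vector (0, v) is isotropic but pairs with the first block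
    through [E]; the resulting hyperbolic planes supply one negative direction per kernel dimension.
    These, the frame rows below [lam] and the rows (0, U) are mutually orthogonal. *)
Lemma neg_dim_pencil lam d : lam \is Num.real -> neg_dim M d ->
  neg_dim (pencil lam)
    (#|[set i | D 0 i < lam]| + (\rank (kermx M) + d)).
Proof.
move=> lr [U Un]; set A := [set i | _].
set S := rowsub (@enum_val _ (mem A)) X.
pose H := U *m M *m U^t*.
have Hu : H \in unitmx.
  rewrite -row_free_unit -kermx_eq0; apply/rowV0P => a /sub_kermxP aH.
  apply/eqP; apply/negP => /negP/Un; rewrite hformM -/H /hform aH mul0mx mxE.
  by rewrite ltxx.
have Hh : H^t* = H by rewrite /H !adjM trmxCK Mh mulmxA.
(* [Q] makes the rows [row_mx g (Q - Sg *m V)] orthogonal to [row_mx 0 U], and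
   the shift along V, which M does not see, turns the form on them into -1. *)
pose Q := - (g *m E *m U^t* *m invmx H) *m U.
pose H0 := g *m (L - lam%:M) *m g^t* + Q *m E^t* *m g^t* + g *m E *m Q^t*
   + Q *m M *m Q^t*.
pose Sg := 2^-1 *: (H0 + 1%:M).
have EV : g *m E *m V^t* = 1%:M.
  by rewrite -mulmxA -[E *m _]trmxCK adjM trmxCK.
have VE : V *m E^t* *m g^t* = 1%:M by [].
have MV : M *m V^t* = 0 by rewrite -[RHS](mul_adj_eq0 VM) Mh.
have H0h : H0^t* = H0.
  rewrite /H0; move: (g : 'M_(_, N)) (Q : 'M_(_, k)) => g0 Q0.
  rewrite !adjD !adjM !trmxCK Mh adjD adjN Lh adj_scalar.
  by move/CrealP: (lr) => ->; rewrite !mulmxA; congr (_ + _); rewrite addrAC.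
have Sgh : Sg^t* = Sg.
  rewrite /Sg linearZ /= map_mxZ adjD H0h adj_scalar rmorph1.
  by rewrite fmorphV rmorph_nat.
have QSM : (Q - Sg *m V) *m M = Q *m M.
  by rewrite mulmxBl -(mulmxA Sg) VM mulmx0 subr0.
have QMU : Q *m M *m U^t* = - (g *m E *m U^t*).
  rewrite /Q -(mulmxA _ U M) -(mulmxA _ (U *m M)) -/H.
  by rewrite mulNmx mulmxKV.
pose W := row_mx g (Q - Sg *m V).
exists (col_mx S (col_mx W (row_mx 0 U))).
apply: neg_sub_col; first exact: pencil_herm.
- rewrite /S rowsubE -mulmxA -mulmxA [X *m _]mulmxA frame_pencil adj_col.
  rewrite mul_mx_row !adj_row !mul_row_col adj0 mulmx0 !mul0mx !addr0.
  by rewrite -mulmxA Gg mulmx0 row_mx0 mulmx0.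
- by apply: neg_sub_diag (frame_congr lam) _ => i; rewrite inE !mxE subr_lt0.
apply: neg_sub_col; first exact: pencil_herm.
- rewrite /W /pencil mul_row_block adj_row mul_row_col adj0 mulmx0 add0r.
  by rewrite QSM mulmxDl QMU subrr.
- move=> a aN0; rewrite hformM.
  (* The shift by [Sg *m V] contributes -[Sg] twice to the form [H0] of the unshifted rows, whence
     the factor 1/2 in [Sg]. *)
  have -> : W *m pencil lam *m W^t* = diag_mx (const_mx (-1)).
    rewrite /W /pencil mul_row_block adj_row mul_row_col.
    rewrite QSM adjD adjN (adjM Sg) Sgh.
    rewrite [(_ + (Q - _) *m _) *m _]mulmxDl [(Q - _) *m _]mulmxBl.
    rewrite [(_ - _ *m E^t*) *m _]mulmxBl -(mulmxA Sg V) -(mulmxA Sg) VE mulmx1.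
    rewrite [(_ + Q *m M) *m _]mulmxBr (mulmxA _ (V^t*)).
    rewrite [(_ + Q *m M) *m V^t*]mulmxDl EV -(mulmxA Q M (V^t*)) MV mulmx0.
    rewrite addr0 mul1mx [(_ + Q *m M) *m _]mulmxDl.
    rewrite diag_const_mx raddfN /=.
    have -> : g *m (L - lam%:M) *m g^t* + (Q *m E^t* *m g^t* - Sg) +
       (g *m E *m Q^t* + Q *m M *m Q^t* - Sg) = H0 - (Sg + Sg).
      rewrite /H0; move: (g *m (L - lam%:M) *m g^t*) (Q *m E^t* *m g^t*).
      move: (g *m E *m Q^t*) (Q *m M *m Q^t*) => a1 a2 a3 a4.
      by rewrite opprD !addrA [LHS](ACl (1*2*4*5*3*6)).
    rewrite /Sg -scalerDl; have := splitr (1 : C); rewrite div1r => <-.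
    by rewrite scale1r opprD addrA subrr sub0r.
  rewrite hform_diag.
  have [i ai] := rV_neq0 aN0.
  rewrite (bigD1 i) //= -[ltRHS](addr0 0) ltr_leD //.
    by rewrite mxE mulrN1 oppr_lt0 exprn_gt0 // normr_gt0.
  by apply: sumr_le0 => j _; rewrite mxE mulrN1 oppr_le0 exprn_ge0.
- move=> a aN0; have := Un a aN0; rewrite !hformM; congr (hform _ _ < 0).
  rewrite /pencil mul_row_block adj_row mul_row_col adj0 mulmx0 !mul0mx !add0r.
  by [].
Qed.
End Frame.

(** If the dimensions taken for [M] add up to [k], those obtained for the pencil add up to N + k, so
    its negative index is known exactly. *)
Theorem pencil_inertia : exists n (D : 'rV[C]_n),
  [/\ (n + \rank (kermx M))%N = N,
      forall i, D 0 i \is Num.real,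
      forall lam, \rank (kermx (pencil lam)) = #|[set i | D 0 i == lam]|,
      forall lam d, lam \is Num.real -> neg_dim M d -> neg_dim (pencil lam)
        (#|[set i | D 0 i < lam]| + (\rank (kermx M) + d)) &
      forall lam d, lam \is Num.real -> psd_dim M d ->
        psd_dim (pencil lam) (#|[set i | lam <= D 0 i]| + d)].
Proof.
have [V [VM gg]] := ker_frame.
have [n [G [P [D [nr Dr [GG Gg GGgg] GLP GEP]]]]] := eigen_frame VM gg.
exists n, D; split=> // lam.
- exact: (rank_ker_pencil VM gg Dr GG GGgg GLP GEP).
- move=> d lr; exact: (neg_dim_pencil VM gg GG Gg GLP GEP).
- move=> d lr; exact: (psd_dim_pencil GG GLP GEP).
Qed.
End Pencil.
End Inertia.

(** * Eigenvalue counts *)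

Section SortedCount.
Variable R : realDomainType.
Implicit Types s t : seq R.

Definition nlt (l : R) s : nat := count (fun x => x < l) s.

Lemma count_lt_nth s n : sorted <=%R s -> (n < size s)%N ->
  (nlt (nth 0%R s n) s <= n)%N.
Proof.
move=> ss ns; rewrite -{2}[s](cat_take_drop n) /nlt count_cat.
rewrite -/(nlt _ _) -/(nlt _ _).
have -> : nlt (nth 0 s n) (drop n s) = 0%N.
  apply/eqP; rewrite -leqn0 leqNgt -has_count; apply/hasPn => x /(nthP 0).
  rewrite size_drop => -[i ilt <-]; rewrite nth_drop -leNgt.
  by apply: le_sorted_leq_nth ss _ _ _ _ _; rewrite ?inE ?leq_addr // -ltn_subRL.
by rewrite addn0 (leq_trans (count_size _ _)) // size_take ns.
Qed.

Lemma count_lt_nth_gt t n l : sorted <=%R t -> (n < size t)%N ->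
  nth 0 t n < l -> (n < nlt l t)%N.
Proof.
move=> st nt ltl; rewrite -[t](cat_take_drop n.+1) /nlt count_cat.
rewrite -/(nlt _ _) -/(nlt _ _).
suff /eqP -> : nlt l (take n.+1 t) == size (take n.+1 t).
  by rewrite size_takel // leq_addr.
rewrite -all_count; apply/allP => x /(nthP 0).
rewrite size_takel // => -[i ilt <-]; rewrite nth_take //.
apply: le_lt_trans ltl; apply: le_sorted_leq_nth st _ _ _ _ _;
  by rewrite ?inE // (leq_trans ilt).
Qed.

(** A defect [d] between counting functions becomes an index shift by [d]. Otherwise the level
    [nth 0 s n] would have more than n + d entries of [t] below it, but at most n of [s]. *)
Lemma nth_le_of_count s t d n : sorted <=%R s -> sorted <=%R t ->
  (forall l, (nlt l t <= nlt l s + d)%N) ->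
  (n < size s)%N -> (n + d < size t)%N -> nth 0 s n <= nth 0 t (n + d).
Proof.
move=> ss st le ns nt; rewrite leNgt; apply/negP => lt.
have := le (nth 0 s n); have := count_lt_nth_gt st nt lt.
have := count_lt_nth ss ns; lia.
Qed.

(** The case where the compressed boundary entry is 0, so that [t] is one entry shorter than the
    other lists. *)
Lemma interlacing_regular n s1 s2 t :
  sorted <=%R s1 -> sorted <=%R s2 -> sorted <=%R t ->
  size s1 = n.+2 -> size s2 = n.+2 -> size t = n.+1 ->
  (forall l, [/\ nlt l s2 <= nlt l s1, nlt l t <= nlt l s2
     & nlt l s1 <= nlt l t + 1]%N) ->
  (forall m : nat, (m <= n)%N ->
     nth 0 s1 m <= nth 0 s2 m /\ nth 0 s2 m <= nth 0 t m /\
     nth 0 t m <= nth 0 s1 m.+1) /\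
  nth 0 s1 n.+1 <= nth 0 s2 n.+1.
Proof.
move=> so1 so2 sot z1 z2 zt h.
have le12 m : (m < n.+2)%N -> nth 0 s1 m <= nth 0 s2 m.
  move=> mN; rewrite -[m in leRHS]addn0.
  apply: nth_le_of_count => //; rewrite ?z1 ?z2 ?addn0 // => l.
  by rewrite addn0; case: (h l).
split; last by rewrite le12.
move=> m mn; split; first by rewrite le12 //; lia.
split.
  rewrite -[m in leRHS]addn0.
  apply: nth_le_of_count => //; rewrite ?zt ?z2 ?addn0 //; try lia.
  by move=> l; rewrite addn0; case: (h l).
rewrite -addn1; apply: nth_le_of_count => //; rewrite ?zt ?z1 //; try lia.
by move=> l; case: (h l).
Qed.

(** Here [t] is full, while [s2] loses an entry when its parameter sits at the threshold (r = 1);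
    its last [nth] would then be the default 0, hence the proviso on [r]. *)
Lemma interlacing_singular n s1 s2 s3 s4 t r :
  sorted <=%R s1 -> sorted <=%R s2 -> sorted <=%R s3 -> sorted <=%R s4 ->
  sorted <=%R t -> size s1 = n.+2 -> (size s2 + r)%N = n.+2 -> (r <= 1)%N ->
  size s3 = n.+2 -> size s4 = n.+2 -> size t = n.+2 ->
  (forall l, [/\ nlt l s4 <= nlt l s3, nlt l t <= nlt l s4, nlt l s1 <= nlt l t,
     nlt l s2 <= nlt l s1 & nlt l s3 <= nlt l s2 + 1]%N) ->
  (forall m : nat, (m <= n)%N ->
     nth 0 s3 m <= nth 0 s4 m /\ nth 0 s4 m <= nth 0 t m /\
     nth 0 t m <= nth 0 s1 m /\ nth 0 s1 m <= nth 0 s2 m /\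
     nth 0 s2 m <= nth 0 s3 m.+1) /\
  (nth 0 s3 n.+1 <= nth 0 s4 n.+1 /\ nth 0 s4 n.+1 <= nth 0 t n.+1 /\
   nth 0 t n.+1 <= nth 0 s1 n.+1) /\
  (r = 0%N -> nth 0 s1 n.+1 <= nth 0 s2 n.+1).
Proof.
move=> so1 so2 so3 so4 sot z1 z2 r1 z3 z4 zt h.
have le u v m : sorted <=%R u -> sorted <=%R v ->
    (forall l, nlt l v <= nlt l u)%N -> (m < size u)%N -> (m < size v)%N ->
    nth 0 u m <= nth 0 v m.
  move=> su sv huv mu mv; rewrite -[m in leRHS]addn0.
  by apply: nth_le_of_count; rewrite ?addn0 // => l; rewrite addn0.
have le34 m : (m < n.+2)%N -> nth 0 s3 m <= nth 0 s4 m.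
  by move=> mN; apply: le; rewrite ?z3 ?z4 // => l; case: (h l).
have le4t m : (m < n.+2)%N -> nth 0 s4 m <= nth 0 t m.
  by move=> mN; apply: le; rewrite ?zt ?z4 // => l; case: (h l).
have let1 m : (m < n.+2)%N -> nth 0 t m <= nth 0 s1 m.
  by move=> mN; apply: le; rewrite ?zt ?z1 // => l; case: (h l).
have le12 m : (m < n.+2)%N -> (m < size s2)%N -> nth 0 s1 m <= nth 0 s2 m.
  by move=> mN m2; apply: le; rewrite ?z1 // => l; case: (h l).
split.
  move=> m mn; have mN : (m < n.+2)%N by lia.
  have m2 : (m < size s2)%N by lia.
  rewrite le34 // le4t // let1 // le12 //; do 4!split=> //.
  rewrite -addn1; apply: nth_le_of_count => //; rewrite ?z3; try lia.
  by move=> l; case: (h l).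
split; first by rewrite le34 ?le4t ?let1.
by move=> r0; rewrite le12 //; lia.
Qed.

End SortedCount.

(** * Negative indices as counting functions of real spectra *)

Section RealSpectrum.
Variable R : rcfType.
Local Notation C := R[i].

Lemma rC_real (x : R) : rC x \is Num.real.
Proof. by apply/complex_realP; exists x. Qed.

Lemma conj_rC (x : R) : Num.conj (rC x) = rC x.
Proof. exact/CrealP/rC_real. Qed.

Lemma rC_lt0 (x : R) : (rC x < 0) = (x < 0).
Proof. exact: (ltcR x 0). Qed.

Lemma rC_ge0 (x : R) : (0 <= rC x) = (0 <= x).
Proof. exact: (lecR 0 x). Qed.

(** Two subspaces of complementary dimensions pin the negative index at each real level to the
    counting function of [s] plus a constant offset [c]. *)
Definition inertia m (K : C -> 'M[C]_m) (c : nat) (s : seq R) := forall l : R,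
  let d := (nlt l s + c)%N in
  [/\ (d <= m)%N, neg_dim (K (rC l)) d & psd_dim (K (rC l)) (m - d)].

Lemma inertia_mono m (K1 K2 : C -> 'M[C]_m) c1 c2 s1 s2 l :
  (forall x, hform (K1 (rC l)) x <= hform (K2 (rC l)) x) ->
  inertia K1 c1 s1 -> inertia K2 c2 s2 ->
  (nlt l s2 + c2 <= nlt l s1 + c1)%N.
Proof.
move=> le /(_ l) /= [d1 _ p1] /(_ l) /= [_ n2 _].
by have := neg_psd_dim_le (neg_dim_le le n2) p1; lia.
Qed.

(** Cauchy interlacing: subspaces of the compression lift through [J]. The negative ones bound the
    larger index from below, the semidefinite ones from above up to the codimension. *)
Lemma inertia_compr m m' (J : 'M[C]_(m', m)) (K : C -> 'M[C]_m)
    (K' : C -> 'M[C]_m') c c' s s' l :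
  row_free J -> K' (rC l) = J *m K (rC l) *m J^t* ->
  inertia K c s -> inertia K' c' s' ->
  (nlt l s' + c' <= nlt l s + c)%N /\
  (nlt l s + c <=
     nlt l s' + c' + (m - m'))%N.
Proof.
move=> Jf E /(_ l) /= [d n p] /(_ l) /= [d' n' p'].
rewrite E in n' p'; have mm : (m' <= m)%N.
  by move/eqP: Jf => <-; apply: rank_leq_col.
have := neg_psd_dim_le (neg_dim_compr n') p.
have := neg_psd_dim_le n (psd_dim_compr Jf p').
lia.
Qed.

Lemma card_count_enum n (p : pred 'I_n) : #|[set i | p i]| = count p (enum 'I_n).
Proof. by rewrite cardsE cardE [enum p]/(enum_mem _) size_filter -enumT. Qed.

Lemma inertia_diag k (M T : 'M[C]_k) (d : 'I_k -> R) :
  T \in unitmx -> T *m M *m T^t* = diag_mx (\row_i rC (d i)) ->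
  [/\ neg_dim M #|[set i | d i < 0]|, psd_dim M #|[set i | 0 <= d i]| &
      \rank (kermx M) = #|[set i | d i == 0]|].
Proof.
move=> Tu E; split.
- eexists; apply: neg_sub_diag E _ => i; by rewrite inE mxE rC_lt0.
- eexists; last first.
    by apply: psd_sub_diag E _ => i; rewrite inE mxE rC_ge0.
  apply: row_free_rowsub; first exact: enum_val_inj.
  by rewrite row_free_unit.
- set A := [set i | _]; set S := rowsub (@enum_val _ (mem A)) T.
  have Sf : row_free S.
    by apply: row_free_rowsub; [exact: enum_val_inj | rewrite row_free_unit].
  have Tu' : T^t* \in unitmx by rewrite map_unitmx unitmx_tr.
  move/eqP: (Sf) => <-; apply: eqmx_rank; apply/andP; split.
    apply/rV_subP => x /sub_kermxP xM; pose b := x *m invmx T.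
    have bT : x = b *m T by rewrite mulmxKV.
    have bd : b *m diag_mx (\row_i rC (d i)) = 0.
      by rewrite -E !mulmxA -bT xM mul0mx.
    rewrite bT; apply: sub_rowsub => i; rewrite inE => di.
    have := congr1 (fun B : 'rV_k => B 0 i) bd.
    rewrite mul_mx_diag !mxE => /eqP; rewrite mulf_eq0 => /orP[/eqP //|].
    by rewrite (inj_eq (@complexI R)) (negPf di).
  apply/sub_kermxP; apply: (can_inj (mulmxK Tu')).
  rewrite mul0mx /S rowsubE -!mulmxA [T *m _]mulmxA E rowsub_diag0 // => i.
  by rewrite inE mxE => /eqP ->.
Qed.

(** The offset counts zero entries along with negative ones: each kernel direction of [M] costs an
    eigenvalue and adds a negative direction. *)
Theorem pencil_spectrum N k (L : 'M[C]_N) (E : 'M[C]_(N, k)) (M T : 'M[C]_k)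
    (d : 'I_k -> R) :
  L^t* = L -> M^t* = M -> row_free (E^t*) -> T \in unitmx ->
  T *m M *m T^t* = diag_mx (\row_i rC (d i)) ->
  exists s : seq R,
   [/\ sorted <=%R s, (size s + #|[set i | d i == 0%R]|)%N = N,
       forall lam, \rank (kermx (pencil L E M lam))
         = count (fun x => rC x == lam) s &
       inertia (pencil L E M) #|[set i | d i <= 0%R]| s].
Proof.
move=> Lh Mh Ef Tu TE; have [nM pM rM] := inertia_diag Tu TE.
have [n [D [nr Dr mD nD pD]]] := pencil_inertia Lh Mh Ef.
pose e i := complex.Re (D 0 i).
have De i : D 0 i = rC (e i) by rewrite /e /rC RRe_real.
pose s := sort <=%R [seq e i | i <- enum 'I_n].
have cs (p : pred R) : count p s = #|[set i | p (e i)]|.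
  by rewrite /s count_sort count_map card_count_enum.
exists s; split.
- exact/sort_sorted/le_total.
- by rewrite /s size_sort size_map size_enum_ord -rM.
- by move=> lam; rewrite mD cs; apply: eq_card => i; rewrite !inE De.
move=> l; have lr := rC_real l.
have := nD _ _ lr nM; have := pD _ _ lr pM.
have -> : #|[set i | D 0 i < rC l]| = nlt l s.
  by rewrite /nlt cs; apply: eq_card => i; rewrite !inE De ltcR.
have -> : #|[set i | rC l <= D 0 i]| = (n - nlt l s)%N.
  rewrite /nlt cs cardsCs card_ord; congr (_ - _)%N; apply: eq_card => i.
  by rewrite !inE De lecR ltNge.
have -> : #|[set i | 0 <= d i]| = (k - #|[set i | (d i < 0)%R]|)%N.
  rewrite cardsCs card_ord; congr (_ - _)%N; apply: eq_card => i.
  by rewrite !inE ltNge.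
have -> : #|[set i | d i <= 0]| = (\rank (kermx M) + #|[set i | (d i < 0)%R]|)%N.
  rewrite rM -cardsUI (_ : _ :&: _ = set0) ?cards0 ?addn0.
    by apply: eq_card => i; rewrite !inE le_eqVlt.
  by apply/setP => i; rewrite !inE; case: eqP => // ->; rewrite ltxx.
have ns : (nlt l s <= n)%N.
  by rewrite (leq_trans (count_size _ _)) // size_sort size_map size_enum_ord.
have nk : (#|[set i | (d i < 0)%R]| <= k)%N.
  by rewrite -[X in (_ <= X)%N](card_ord k) max_card.
move: ns nk nr; move: (nlt l s) #|[set i | (d i < 0)%R]| (\rank _).
move=> a m r an mk nrN pK nK; split=> //; first by rewrite -nrN; lia.
by rewrite (_ : _ - _ = n - a + (k - m))%N // -[in LHS]nrN; lia.
Qed.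
End RealSpectrum.

(** * Reduction of the boundary value problem *)

(** Applied in both directions to equate kernel dimensions; injectivity of [h] is asked on the
    kernel of [A] alone. *)
Lemma rank_ker_le (F : fieldType) m p m' p' (A : 'M[F]_(m, p))
    (B : 'M[F]_(m', p')) (h : 'rV[F]_m -> 'rV[F]_m') :
  linear h ->
  (forall x, x *m A = 0 -> h x *m B = 0) ->
  (forall x, x *m A = 0 -> h x = 0 -> x = 0) ->
  (\rank (kermx A) <= \rank (kermx B))%N.
Proof.
move=> hlin hAB hinj.
pose hL : {linear 'rV[F]_m -> 'rV[F]_m'} :=
  HB.pack h (GRing.isLinear.Build F _ _ *:%R h hlin).
pose H := lin1_mx hL.
have hE x : x *m H = h x by rewrite mul_rV_lin1.
pose U := row_base (kermx A).
have UA (a : 'rV_(\rank (kermx A))) : a *m U *m A = 0.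
  rewrite -mulmxA (_ : U *m A = 0) ?mulmx0 //.
  by apply/sub_kermxP; rewrite eq_row_base.
have /eqP <- : row_free (U *m H).
  rewrite -kermx_eq0; apply/rowV0P => a /sub_kermxP; rewrite mulmxA hE.
  by move/(hinj _ (UA a))/eqP; rewrite mulmx_free_eq0 ?row_base_free // => /eqP.
apply: mxrankS; apply/rV_subP => x /submxP [a ->]; apply/sub_kermxP.
by rewrite mulmxA hE; apply: hAB.
Qed.

Section Reduction.
Variables (R : rcfType) (n : nat) (f q w : nat -> R).
Local Notation C := R[i].
Local Notation N := n.+2.
Hypothesis hf : forall m : nat, (m <= N)%N -> f m != 0.
Hypothesis hw : forall m : nat, (1 <= m <= N)%N -> 0 < w m.

(** * The Jacobi matrix and the change of unknowns *)

Definition sqw (m : nat) : C := rC (Num.sqrt (w m)).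

(* f with its end values f_0 and f_N replaced by 0: their contributions to the
   first and the last equation are the boundary unknowns s and t. *)
Definition innerf (m : nat) : C := if (0 < m < N)%N then rC (f m) else 0.

(** Index [i] stands for the node n = i + 1; the division by the roots of the weights turns the
    weight into the identity. *)
Definition jacobi : 'M[C]_N := \matrix_(i, j)
  (((i == j)%:R * (innerf j + innerf j.+1 + rC (q j.+1))
    - (i == j.+1 :> nat)%:R * innerf i - (j == i.+1 :> nat)%:R * innerf j)
   / (sqw i.+1 * sqw j.+1)).

(** Applied to the rescaled interior values it reads off (y_1, y_N); its adjoint inserts the
    boundary unknowns s and t into the first and last equations. *)
Definition ends : 'M[C]_(N, 2) := \matrix_(i, j)
  if j == i0 then (i == 0%N :> nat)%:R / sqw 1
  else (i == n.+1 :> nat)%:R / sqw N.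

Lemma sqw_neq0 m : (1 <= m <= N)%N -> sqw m != 0.
Proof.
by move=> /hw wm; rewrite (inj_eq (@complexI R)) gt_eqF // sqrtr_gt0.
Qed.

Lemma sqwK m : (1 <= m <= N)%N -> sqw m * sqw m = rC (w m).
Proof.
move=> /hw wm; rewrite /sqw /rC -rmorphM /= -expr2 sqr_sqrtr //; exact: ltW.
Qed.

Lemma conj_sqw m : Num.conj (sqw m) = sqw m. Proof. exact: conj_rC. Qed.

Lemma conj_innerf m : Num.conj (innerf m) = innerf m.
Proof. by rewrite /innerf; case: ifP; rewrite ?conj_rC ?rmorph0. Qed.

Lemma jacobi_herm : jacobi^t* = jacobi.
Proof.
apply/matrixP => i j; rewrite !mxE fmorph_div !rmorphB !rmorphM !rmorphD.
rewrite !rmorph_nat /= !conj_sqw !conj_innerf conj_rC.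
rewrite [sqw j.+1 * _]mulrC; congr (_ / _).
rewrite eq_sym; have [->|_] := eqVneq i j.
  by rewrite addrAC.
by rewrite !mul0r !sub0r addrC.
Qed.

Lemma ends_free : row_free (ends^t*).
Proof.
rewrite -kermx_eq0; apply/rowV0P => a /sub_kermxP E.
have s1 : sqw 1 != 0 by apply: sqw_neq0.
have sN : sqw N != 0 by apply: sqw_neq0; rewrite leqnn.
apply/rowP => j; rewrite mxE.
have E0 := congr1 (fun B : 'rV_N => B 0 ord0) E.
have EN := congr1 (fun B : 'rV_N => B 0 ord_max) E.
move: E0 EN; rewrite !mxE !big_ord_recl !big_ord0 !mxE /=.
rewrite !addr0 !mul0r !mul1r !rmorph0 !mulr0 !addr0 !add0r !fmorphV /= !conj_sqw.
move/eqP; rewrite mulf_eq0 invr_eq0 (negPf s1) orbF => /eqP a0.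
move/eqP; rewrite eqxx mul1r fmorphV /= conj_sqw mulf_eq0 invr_eq0 (negPf sN).
rewrite orbF => /eqP a1.
case: (unliftP ord0 j) => [j' ->|->] //.
by rewrite (_ : lift ord0 j' = lift ord0 ord0) //; apply/val_inj; rewrite /= ord1.
Qed.

Definition ev (u : 'rV[C]_N.+2) (m : nat) : C := u 0 (inord m).

Definition interior (u : 'rV[C]_N.+2) : 'rV[C]_N :=
  \row_i (ev u i.+1 * sqw i.+1).

Definition bdata (u : 'rV[C]_N.+2) : 'rV[C]_2 := \row_j
  if j == i0 then rC (f 0) * (ev u 1 - ev u 0)
  else - (rC (f N) * (ev u N.+1 - ev u N)).

(** Inverse of the map ([interior], [bdata]): y_0 and y_{N+1} come back from s and t because f_0 and
    f_N are nonzero. *)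
Definition extend (Y : 'rV[C]_N) (v : 'rV[C]_2) : 'rV[C]_N.+2 := \row_m
  if m == 0%N :> nat then Y 0 ord0 / sqw 1 - v 0 i0 / rC (f 0)
  else if m == N.+1 :> nat then Y 0 ord_max / sqw N - v 0 i1 / rC (f N)
  else Y 0 (inord m.-1) / sqw m.

Lemma ev_extend Y v m : (m <= N.+1)%N -> ev (extend Y v) m =
  if m == 0%N then Y 0 ord0 / sqw 1 - v 0 i0 / rC (f 0)
  else if m == N.+1 then Y 0 ord_max / sqw N - v 0 i1 / rC (f N)
  else Y 0 (inord m.-1) / sqw m.
Proof. by move=> mN; rewrite /ev mxE inordK. Qed.

Lemma rCf_neq0 m : (m <= N)%N -> rC (f m) != 0.
Proof. by move=> /hf fm; rewrite (inj_eq (@complexI R)). Qed.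

Lemma interior_extend Y v : interior (extend Y v) = Y.
Proof.
apply/rowP => i; have iN := ltn_ord i; rewrite mxE ev_extend; last by lia.
rewrite /= ifF; last by lia.
by rewrite divfK ?sqw_neq0 ?inord_val.
Qed.

Lemma bdata_extend Y v : bdata (extend Y v) = v.
Proof.
have iN1 : inord N.-1 = ord_max :> 'I_N by apply/val_inj; rewrite /= inordK.
have f0 : rC (f 0) != 0 by apply: rCf_neq0.
have fN : rC (f N) != 0 by apply: rCf_neq0.
apply/rowP => j; rewrite mxE !ev_extend //= eqxx.
have -> : (N == N.+1) = false by lia.
have -> : inord 0 = ord0 :> 'I_N by apply/val_inj; rewrite /= inordK.
rewrite -[n.+1]/N.-1 iN1; case: ifPn => [/eqP ->|jN].
  by rewrite opprB addrC subrK mulrC divfK.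
have -> : j = i1 by apply/val_inj; case: j jN => [[|[|]]].
by rewrite addrAC subrr add0r mulrN opprK mulrC divfK.
Qed.

Lemma extendK u : extend (interior u) (bdata u) = u.
Proof.
have f0 : rC (f 0) != 0 by apply: rCf_neq0.
have fN : rC (f N) != 0 by apply: rCf_neq0.
apply/rowP => m; have mN := ltn_ord m; rewrite mxE.
have [m0|m0] := eqVneq (m : nat) 0%N.
  rewrite !mxE /= mulfK ?sqw_neq0 // mulrC mulKf // opprB addrC subrK /ev.
  by congr (u _ _); apply/val_inj; rewrite /= inordK.
have [mN1|mN1] := eqVneq (m : nat) N.+1.
  rewrite !mxE /= mulfK ?sqw_neq0 ?leqnn // mulNr opprK mulrC mulKf //.
  by rewrite addrC subrK /ev; congr (u _ _); apply/val_inj; rewrite /= inordK.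
rewrite !mxE inordK; last by lia.
rewrite prednK ?lt0n // mulfK ?sqw_neq0 //; last by lia.
by rewrite /ev inord_val.
Qed.

(** * The boundary value problem as a pencil *)

Lemma residual_linear P lam (u : 'rV[C]_N.+2) (j : 'I_N.+2) :
  (u *m sl_mx N f q w P lam) 0 j = residual N f q w P lam (ev u) j.
Proof.
have S m : (m < N.+2)%N -> \sum_i u 0 i * (m == i :> nat)%:R = ev u m.
  move=> mN; rewrite (bigD1 (inord m)) //= inordK // eqxx mulr1 big1 ?addr0 //.
  move=> i iN; case: eqP => [E|_]; last by rewrite mulr0.
  by case/eqP: iN; apply/val_inj; rewrite /= inordK.
rewrite mxE; under eq_bigr do rewrite mxE.
rewrite /residual; case: ifPn => jN.
  (* The residual of a basis vector is a combination of node indicators, so the sums collapse to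
     values of [u]. *)
  under eq_bigr => i _.
    rewrite (_ : _ * _ =
      - rC (f j.+1) * (u 0 i * (j.+2 == i :> nat)%:R)
      + (rC (f j.+1) + rC (f j) + rC (q j.+1) - lam * rC (w j.+1))
         * (u 0 i * (j.+1 == i :> nat)%:R)
      - rC (f j) * (u 0 i * (j == i :> nat)%:R)); last by rewrite /=; ring.
    over.
  rewrite big_split big_split /= sumrN -!mulr_sumr !S; try lia.
  by ring.
under eq_bigr => i _.
  set r : 'I_2 := inord _.
  rewrite (_ : _ * _ =
     (bcA P r i0 - bcA P r i1 * rC (f 0)) * (u 0 i * (0%N == i :> nat)%:R)
     + bcA P r i1 * rC (f 0) * (u 0 i * (1%N == i :> nat)%:R)
     + (bcB P r i0 - bcB P r i1 * rC (f N)) * (u 0 i * (N == i :> nat)%:R)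
     + bcB P r i1 * rC (f N) * (u 0 i * (N.+1 == i :> nat)%:R)); last by ring.
  over.
rewrite !big_split /= -!mulr_sumr !S; try lia.
by ring.
Qed.

(** The factor [sqw j.+1] undoes the symmetric scaling, and s and t restore the end terms with f_0
    and f_N that [innerf] leaves out. *)
Lemma residual_interior P lam (u : 'rV[C]_N.+2) (j : 'I_N) :
  residual N f q w P lam (ev u) j =
  sqw j.+1 * (interior u *m (jacobi - lam%:M) + bdata u *m ends^t*) 0 j.
Proof.
have jN := ltn_ord j; rewrite /residual jN /=.
have sj : sqw j.+1 != 0 by apply: sqw_neq0; lia.
have S m (c : 'I_N -> C) : \sum_i c i * (i == m :> nat)%:R =
    if (m < N)%N then c (inord m) else 0.
  case: ifPn => mN.
    rewrite (bigD1 (inord m)) //= inordK // eqxx mulr1 big1 ?addr0 //.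
    move=> i iN; case: eqP => [E|_]; last by rewrite mulr0.
    by case/eqP: iN; apply/val_inj; rewrite /= inordK.
  rewrite big1 // => i _; case: eqP => [E|_]; last by rewrite mulr0.
  by have := ltn_ord i; lia.
have bE : (bdata u *m ends^t*) 0 j * sqw j.+1 =
   (j == 0%N :> nat)%:R * (rC (f 0) * (ev u 1 - ev u 0))
   - (j == n.+1 :> nat)%:R * (rC (f N) * (ev u N.+1 - ev u N)).
  rewrite mxE !big_ord_recl big_ord0 !mxE /= addr0.
  rewrite !fmorph_div !rmorph_nat /= !conj_sqw mulrDl.
  have [j0|_] := eqVneq (j : nat) 0%N; have [j1|_] := eqVneq (j : nat) n.+1;
    rewrite ?j0 ?j1 /= ?mul0r ?mulr0 ?mul0r ?mul1r ?addr0 ?add0r ?oppr0 ?addr0 //.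
  - by lia.
  - by rewrite divfK // -j0.
  - by rewrite divfK // -j1.
have JE : sqw j.+1 * (interior u *m jacobi) 0 j =
    ev u j.+1 * (innerf j + innerf j.+1 + rC (q j.+1))
    - ev u j.+2 * innerf j.+1 - ev u j * innerf j.
  rewrite mxE mulr_sumr.
  under eq_bigr => i _.
    rewrite !mxE -(inj_eq val_inj) (_ : _ * _ =
      ev u i.+1 * (innerf j + innerf j.+1 + rC (q j.+1)) * (i == j :> nat)%:R
      + - (ev u i.+1 * innerf i * (i == j.+1 :> nat)%:R)
      + - (ev u i.+1 * innerf j * (j == i.+1 :> nat)%:R)); last first.
      have si : sqw i.+1 != 0 by apply: sqw_neq0; have := ltn_ord i; lia.
      by rewrite /=; field; rewrite si sj.
    over.
  rewrite !big_split /= !sumrN !S jN inordK // -!addrA; congr (_ + _).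
  (* A neighbour outside the nodes 1 to N contributes nothing, since [innerf] vanishes at 0 and
     N. *)
  congr (- _ + - _).
    case: ifPn => j1; first by rewrite inordK.
    by rewrite /innerf ifF ?mulr0 //; lia.
  case: (j : nat) jN => [|j'] j'N.
    by rewrite big1 /innerf /= ?mulr0 // => i _; rewrite mulr0.
  under eq_bigr do rewrite eqSS eq_sym.
  by rewrite S ifT ?inordK //; lia.
have dec (A B D : 'rV[C]_N) :
    (A - lam *: D + B) 0 j = A 0 j - lam * D 0 j + B 0 j.
  by rewrite !mxE.
rewrite mulmxBr mul_mx_scalar dec [RHS]mulrDr [X in _ = X + _]mulrBr JE.
rewrite [sqw _ * (bdata _ *m _) _ _]mulrC bE mxE.
rewrite (_ : sqw j.+1 * (lam * (ev u j.+1 * sqw j.+1)) =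
   lam * rC (w j.+1) * ev u j.+1); last first.
  by rewrite -sqwK; [ring | lia].
rewrite /innerf; have -> : (0 < j.+1 < N)%N = (j != n.+1 :> nat) by lia.
have -> : (0 < j < N)%N = (j != 0%N :> nat) by lia.
have [j0|_] := eqVneq (j : nat) 0%N; have [j1|_] := eqVneq (j : nat) n.+1;
  rewrite ?j0 ?j1 /=; [by lia | ring | ring | ring].
Qed.

Lemma extend_linear a Y1 Y2 v1 v2 :
  extend (a *: Y1 + Y2) (a *: v1 + v2) = a *: extend Y1 v1 + extend Y2 v2.
Proof.
apply/rowP => m; rewrite !mxE; case: ifP => _; first by ring.
by case: ifP => _; ring.
Qed.

Lemma extend0 : extend 0 0 = 0.
Proof. by apply/rowP => m; rewrite !mxE !mul0r !subr0; do 2?case: ifP. Qed.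

Lemma interior_linear : linear interior.
Proof. by move=> a u v; apply/rowP => i; rewrite !mxE /ev !mxE; ring. Qed.

Lemma bdata_linear : linear bdata.
Proof.
move=> a u v; apply/rowP => i; rewrite !mxE /ev !mxE.
by case: ifP => _; ring.
Qed.

Lemma interior_ends u :
  (interior u *m ends) 0 i0 = ev u 1 /\ (interior u *m ends) 0 i1 = ev u N.
Proof.
have s1 : sqw 1 != 0 by apply: sqw_neq0.
have sN : sqw N != 0 by apply: sqw_neq0; rewrite leqnn.
split; rewrite mxE.
  rewrite (bigD1 ord0) //= big1 => [|i iN]; rewrite !mxE /=.
    by rewrite mul1r mulfK // addr0.
  by rewrite -[i == 0%N :> nat]/(i == ord0) (negPf iN) mul0r mulr0.
rewrite (bigD1 ord_max) //= big1 => [|i iN]; rewrite !mxE /=.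
  by rewrite eqxx mul1r mulfK // addr0.
by rewrite -[i == n.+1 :> nat]/(i == ord_max) (negPf iN) mul0r mulr0.
Qed.

Lemma ord2P (r : 'I_2) : r = i0 \/ r = i1.
Proof. by case: r => [[|[|//]] h]; [left | right]; apply/val_inj. Qed.

(* In terms of u = (y_1, y_N) and v = (s, t), the boundary condition P says that v
   lies in the row space of jj and that u + v M vanishes along it. *)
Definition bc_reduced (P : bcond R) k (jj : 'M[C]_(k, 2)) (M : 'M[C]_2) :=
  forall u v : 'rV[C]_2,
    (forall r : 'I_2, bcA P r i0 * (u 0 i0 - v 0 i0 / rC (f 0))
       + bcA P r i1 * v 0 i0 + bcB P r i0 * u 0 i1 - bcB P r i1 * v 0 i1 = 0)
    <-> v = v *m jj^t* *m jj /\ (u + v *m M) *m jj^t* = 0.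

Lemma sl_kerP P lam k (jj : 'M[C]_(k, 2)) (M : 'M[C]_2) u :
  bc_reduced P jj M ->
  u *m sl_mx N f q w P lam = 0 <->
  [/\ interior u *m (jacobi - lam%:M) + bdata u *m ends^t* = 0,
      bdata u = bdata u *m jj^t* *m jj
    & (interior u *m ends + bdata u *m M) *m jj^t* = 0].
Proof.
move=> hP; have [e0 e1] := interior_ends u.
have f0 : rC (f 0) != 0 by apply: rCf_neq0.
(* Substituting y_0 = y_1 - s / f_0 and f_N Δy_N = -t puts the boundary rows into the variables of
   [bc_reduced]. *)
have bcE r : residual N f q w P lam (ev u) (N + r) =
    bcA P (inord r) i0 * ((interior u *m ends) 0 i0 - bdata u 0 i0 / rC (f 0))
    + bcA P (inord r) i1 * bdata u 0 i0
    + bcB P (inord r) i0 * (interior u *m ends) 0 i1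
    - bcB P (inord r) i1 * bdata u 0 i1.
  rewrite /residual ltnNge leq_addr /= addKn e0 e1 !mxE /=.
  by rewrite [rC (f 0) * _ / _]mulrC mulKf //; ring.
split=> [u0|[E1 E2 E3]].
  have res0 (j : 'I_N.+2) : residual N f q w P lam (ev u) j = 0.
    by rewrite -residual_linear u0 mxE.
  have [E2 E3] : bdata u = bdata u *m jj^t* *m jj /\
     (interior u *m ends + bdata u *m M) *m jj^t* = 0.
    apply/hP => r; have rN : (N + r < N.+2)%N by have := ltn_ord r; lia.
    by have := res0 (Ordinal rN); rewrite /= bcE inord_val.
  split=> //; apply/rowP => j; rewrite [RHS]mxE.
  have jN : (j < N.+2)%N by have := ltn_ord j; lia.
  have := res0 (Ordinal jN); rewrite /= residual_interior => /eqP.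
  rewrite mulf_eq0 (negPf (sqw_neq0 _)) ?orFb; last by have := ltn_ord j; lia.
  by move/eqP.
apply/rowP => j; rewrite residual_linear [RHS]mxE.
have [jN|jN] := ltnP j N.
  by rewrite -[j : nat]/(Ordinal jN : nat) residual_interior E1 mxE mulr0.
have jN2 := ltn_ord j.
have rN : (j - N < 2)%N by lia.
have /hP /(_ (Ordinal rN)) E := conj E2 E3.
rewrite -[j : nat](subnKC jN) bcE -[RHS]E.
by rewrite -[(j - N)%N]/(Ordinal rN : nat) inord_val.
Qed.

(** Passing to [interior] and [bdata], and back by [extend], carries each kernel injectively into
    the other; orthonormality of [jj] recovers p from p jj. *)
Lemma mult_pencil P k (jj : 'M[C]_(k, 2)) (M : 'M[C]_2) lam :
  jj *m jj^t* = 1%:M -> bc_reduced P jj M ->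
  mult N f q w P lam =
  \rank (kermx (pencil jacobi (ends *m jj^t*) (jj *m M *m jj^t*) lam)).
Proof.
move=> jj1 hP; apply/eqP; rewrite /mult eqn_leq; apply/andP; split.
  apply: (@rank_ker_le _ _ _ _ _ _ _
    (fun u => row_mx (interior u) (bdata u *m jj^t*))).
  - move=> a u v; rewrite interior_linear bdata_linear mulmxDl -scalemxAl.
    by rewrite scale_row_mx add_row_mx.
  - move=> u /(sl_kerP _ _ hP) [E1 E2 E3].
    rewrite /pencil mul_row_block adjM trmxCK [_ *m (jj *m ends^t*)]mulmxA -E2 E1.
    rewrite [bdata u *m jj^t* *m _]mulmxA [bdata u *m _ *m (_ *m _)]mulmxA -E2.
    by rewrite mulmxA -mulmxDl E3 row_mx0.
  - move=> u /(sl_kerP _ _ hP) [_ E2 _]; rewrite -row_mx0 => /eq_row_mx [I0 b0].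
    by rewrite -[u]extendK I0 E2 b0 mul0mx extend0.
apply: (@rank_ker_le _ _ _ _ _ _ _
    (fun x => extend (lsubmx x) (rsubmx x *m jj))).
- by move=> a u v; rewrite !linearP /= mulmxDl -scalemxAl extend_linear.
- move=> x; rewrite -{1}[x]hsubmxK /pencil mul_row_block -row_mx0.
  rewrite adjM trmxCK => /eq_row_mx [E1 E2]; apply/(sl_kerP _ _ hP).
  rewrite interior_extend bdata_extend; split.
  + by rewrite -mulmxA.
  + by rewrite -[_ *m jj *m _]mulmxA jj1 mulmx1.
  + by move: E2; rewrite !mulmxA -mulmxDl.
- move=> x _ x0; rewrite -[x]hsubmxK.
  have := interior_extend (lsubmx x) (rsubmx x *m jj).
  have := bdata_extend (lsubmx x) (rsubmx x *m jj); rewrite x0.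
  have -> : bdata 0 = 0.
    by apply/rowP => i; rewrite !mxE /ev !mxE; case: ifP => _; ring.
  have -> : interior 0 = 0 by apply/rowP => i; rewrite !mxE /ev !mxE mul0r.
  move=> b0 <-; have -> : rsubmx x = 0.
    by rewrite -[LHS]mulmx1 -jj1 mulmxA -b0 mul0mx.
  by rewrite row_mx0.
Qed.

Definition spectral_index (P : bcond R) k (jj : 'M[C]_(k, 2)) (M : 'M[C]_2) r c :=
  exists s : seq R, [/\ is_spectrum N f q w P s, (size s + r)%N = N &
    inertia (pencil jacobi (ends *m jj^t*) (jj *m M *m jj^t*)) c s].

Lemma reduced_spectrum P k (jj : 'M[C]_(k, 2)) (M : 'M[C]_2) (T : 'M[C]_k)
    (d : 'I_k -> R) :
  jj *m jj^t* = 1%:M -> bc_reduced P jj M -> M^t* = M -> T \in unitmx ->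
  T *m (jj *m M *m jj^t*) *m T^t* = diag_mx (\row_i rC (d i)) ->
  spectral_index P jj M #|[set i | d i == 0%R]| #|[set i | d i <= 0%R]|.
Proof.
move=> jj1 hP Mh Tu TE.
have [||s [ss sz sm si]] :=
  pencil_spectrum jacobi_herm _ _ Tu TE (E := ends *m jj^t*).
- by rewrite !adjM trmxCK Mh mulmxA.
- rewrite adjM trmxCK /row_free mxrankMfree ?ends_free //.
  by apply/row_freeP; exists (jj^t*).
exists s; split=> //; split=> // lam.
by rewrite (mult_pencil _ jj1 hP) sm.
Qed.

(** Multiplicities at real points fix a sorted list, so any given spectrum may be identified with
    the constructed one. *)
Lemma spectrum_unique P s t :
  is_spectrum N f q w P s -> is_spectrum N f q w P t -> s = t.
Proof.
move=> [ss sm] [st tm]; apply: le_sorted_eq => //.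
apply/allP => x _ /=; apply/eqP.
have cE (v : seq R) : count_mem x v = count (fun y => rC y == rC x) v.
  by apply: eq_count => y; rewrite /= (inj_eq (@complexI R)).
by rewrite !cE -sm tm.
Qed.
End Reduction.

(** * The boundary conditions A, S7 and S8 *)

Section Concrete.
Variable R : rcfType.
Local Notation C := R[i].

Definition coupling (z : C) (al b : R) : 'M[C]_2 :=
  mx2 (rC al) (- z) (- conjc z) (rC b).

Lemma mulcJ (z : C) : z * conjc z = rC (normsq z).
Proof. by case: z => a b; rewrite /normsq /rC; simpc; congr (_ +i* _); ring. Qed.

Lemma conjc_rC (x : R) : conjc (rC x) = rC x.
Proof. exact: conjc_real. Qed.

Lemma conjcM (x y : C) : conjc (x * y) = conjc x * conjc y.
Proof. exact: rmorphM. Qed.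

Lemma conjcN (x : C) : conjc (- x) = - conjc x.
Proof. exact: rmorphN. Qed.

Lemma normsq_gt0 (z : C) : z != 0 -> 0 < normsq z.
Proof.
case: z => a b; rewrite eq_complex /normsq /= negb_and => /orP[] h.
  by rewrite ltr_pwDl ?sqr_ge0 // lt0r sqr_ge0 sqrf_eq0 h.
by rewrite ltr_wpDl ?sqr_ge0 // lt0r sqr_ge0 sqrf_eq0 h.
Qed.

Lemma mx2_mul (a b c d a' b' c' d' : C) : mx2 a b c d *m mx2 a' b' c' d' =
  mx2 (a * a' + b * c') (a * b' + b * d') (c * a' + d * c') (c * b' + d * d').
Proof.
apply/matrixP => i j; rewrite !mxE !big_ord_recl big_ord0 !mxE addr0.
by case: (ord2P i) (ord2P j) => -> [] ->.
Qed.

Lemma mx2_adj (a b c d : C) :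
  (mx2 a b c d)^t* = mx2 (conjc a) (conjc c) (conjc b) (conjc d).
Proof.
by apply/matrixP => i j; rewrite !mxE; case: (ord2P i) (ord2P j) => -> [] ->.
Qed.

Lemma mx2_diag (d : 'I_2 -> R) :
  diag_mx (\row_i rC (d i)) = mx2 (rC (d i0)) 0 0 (rC (d i1)).
Proof.
by apply/matrixP => i j; rewrite !mxE; case: (ord2P i) (ord2P j) => -> [] ->.
Qed.

Lemma mx2_1 : mx2 1 0 0 1 = 1%:M :> 'M[C]_2.
Proof.
by apply/matrixP => i j; rewrite !mxE; case: (ord2P i) (ord2P j) => -> [] ->.
Qed.

Lemma mx2_eq (a b c d a' b' c' d' : C) :
  a = a' -> b = b' -> c = c' -> d = d' -> mx2 a b c d = mx2 a' b' c' d'.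
Proof. by move=> -> -> -> ->. Qed.

Lemma coupling_herm z al b : (coupling z al b)^t* = coupling z al b.
Proof. by rewrite mx2_adj !conjc_rC !conjcN conjcK. Qed.

Lemma card_ord2 (p : pred 'I_2) : #|[set i | p i]| = (p i0 + p i1)%N.
Proof.
rewrite card_count_enum (_ : enum 'I_2 = [:: i0; i1]) /= ?addn0 //.
by apply: (inj_map val_inj); rewrite val_enum_ord.
Qed.

Lemma card_ord1 (p : pred 'I_1) : #|[set i | p i]| = p ord0 :> nat.
Proof.
rewrite card_count_enum (_ : enum 'I_1 = [:: ord0]) /= ?addn0 //.
by apply: (inj_map val_inj); rewrite val_enum_ord.
Qed.

(** A diagonalisation of [M] by congruence; [r] is the number of eigenvalues lost and [c] the offset
    in the negative index. *)
Definition coupling_index z al b r c := exists (T : 'M[C]_2) (d : 'I_2 -> R),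
  [/\ T \in unitmx, T *m coupling z al b *m T^t* = diag_mx (\row_i rC (d i)),
      #|[set i | d i == 0]| = r & #|[set i | d i <= 0]| = c].

Lemma unit_of_congr (T M : 'M[C]_2) (d : 'I_2 -> R) :
  (forall i, d i != 0) ->
  T *m M *m T^t* = diag_mx (\row_i rC (d i)) -> T \in unitmx.
Proof.
move=> d0 E; have : T *m (M *m T^t* *m diag_mx (\row_i rC (d i)^-1)) = 1%:M.
  rewrite !mulmxA E !mx2_diag mx2_mul -mx2_1 !mulr0 !mul0r !add0r !addr0.
  by rewrite /rC -!rmorphM !mulfV ?d0.
by case/mulmx1_unit.
Qed.

(** Completing the square in t leaves the Schur complement al - |z|^2 / b, whose zero is the
    threshold in a12. *)
Lemma coupling_index_b z (al b : R) : b != 0 -> coupling_index z al b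
  (al - normsq z / b == 0) ((al - normsq z / b <= 0)%R + (b <= 0)%R)%N.
Proof.
move=> b0; have rb : rC b != 0 by rewrite (inj_eq (@complexI R)).
exists (mx2 1 (z / rC b) 0 1).
exists (fun i => if i == i0 then al - normsq z / b else b); split.
- have : mx2 1 (z / rC b) 0 1 *m mx2 1 (- (z / rC b)) 0 1 = 1%:M.
    by rewrite mx2_mul -mx2_1; apply: mx2_eq; ring.
  by case/mulmx1_unit.
- rewrite mx2_diag /= mx2_adj !mx2_mul conjcM conjc_inv conjc_rC conjc1 conjc0.
  have nz : rC (al - normsq z / b) = rC al - z * conjc z / rC b.
    by rewrite mulcJ /rC rmorphB rmorphM fmorphV.
  by rewrite nz; apply: mx2_eq; field.
- by rewrite card_ord2 /= (negPf b0) addn0.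
- by rewrite card_ord2.
Qed.

(** The same elimination with s as pivot, giving the threshold in b22. *)
Lemma coupling_index_a z (al b : R) : al != 0 -> coupling_index z al b
  (b - normsq z / al == 0) ((al <= 0)%R + (b - normsq z / al <= 0)%R)%N.
Proof.
move=> a0; have ra : rC al != 0 by rewrite (inj_eq (@complexI R)).
exists (mx2 1 0 (conjc z / rC al) 1).
exists (fun i => if i == i0 then al else b - normsq z / al); split.
- have : mx2 1 0 (conjc z / rC al) 1 *m mx2 1 0 (- (conjc z / rC al)) 1 = 1%:M.
    by rewrite mx2_mul -mx2_1; apply: mx2_eq; ring.
  by case/mulmx1_unit.
- rewrite mx2_diag /= mx2_adj !mx2_mul conjcM conjc_inv conjc_rC conjc1 conjc0.
  have nz : rC (b - normsq z / al) = rC b - z * conjc z / rC al.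
    by rewrite mulcJ /rC rmorphB rmorphM fmorphV.
  by rewrite nz conjcK; apply: mx2_eq; field.
- by rewrite card_ord2 /= (negPf a0) add0n.
- by rewrite card_ord2.
Qed.

(* M is indefinite here; the rows (1, sg e * z) have form value e and are
   M-orthogonal for e = 1 and e = -1. *)
Lemma coupling_index_b0 z al : z != 0 -> coupling_index z al 0 0 1.
Proof.
move=> z0; have nz := normsq_gt0 z0.
pose sg e : R := (al - e) / (2 * normsq z).
pose d i : R := if i == i0 :> 'I_2 then 1 else -1.
have z0' : conjc z != 0 by rewrite conjc_eq0.
have sgE e : rC (sg e) = (rC al - rC e) / (2 * (z * conjc z)).
  by rewrite mulcJ /rC /sg rmorphM fmorphV rmorphB rmorphM rmorph_nat.
have E : mx2 1 (rC (sg 1) * z) 1 (rC (sg (-1)) * z) *m coupling z al 0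
   *m (mx2 1 (rC (sg 1) * z) 1 (rC (sg (-1)) * z))^t* = diag_mx (\row_i rC (d i)).
  rewrite mx2_diag /= mx2_adj !mx2_mul !conjcM conjc1 !conjc_rC !sgE /d /=.
  rewrite /rC rmorphN rmorph1 rmorph0 -/(rC _).
  by apply: mx2_eq; field; rewrite z0 z0'.
eexists; exists d; split; last 2 first.
- by rewrite card_ord2 /d /= oner_eq0 oppr_eq0 oner_eq0.
- by rewrite card_ord2 /d /= ler10 lerN10.
- by apply: unit_of_congr E => i; rewrite /d; case: ifP; rewrite ?oppr_eq0 oner_eq0.
- exact: E.
Qed.

(** The determinant is -|z|^2; the rows (sg e * conjc z, 1) realise the form values e = 1 and e =
    -1. *)
Lemma coupling_index_a0 z b : z != 0 -> coupling_index z 0 b 0 1.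
Proof.
move=> z0; have nz := normsq_gt0 z0.
pose sg e : R := (b - e) / (2 * normsq z).
pose d i : R := if i == i0 :> 'I_2 then 1 else -1.
have z0' : conjc z != 0 by rewrite conjc_eq0.
have sgE e : rC (sg e) = (rC b - rC e) / (2 * (z * conjc z)).
  by rewrite mulcJ /rC /sg rmorphM fmorphV rmorphB rmorphM rmorph_nat.
have E : mx2 (rC (sg 1) * conjc z) 1 (rC (sg (-1)) * conjc z) 1 *m coupling z 0 b
   *m (mx2 (rC (sg 1) * conjc z) 1 (rC (sg (-1)) * conjc z) 1)^t*
   = diag_mx (\row_i rC (d i)).
  rewrite mx2_diag /= mx2_adj !mx2_mul !conjcM conjc1 !conjc_rC !sgE /d /=.
  rewrite /rC rmorphN rmorph1 rmorph0 -/(rC _) conjcK.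
  by apply: mx2_eq; field; rewrite z0 z0'.
eexists; exists d; split; last 2 first.
- by rewrite card_ord2 /d /= oner_eq0 oppr_eq0 oner_eq0.
- by rewrite card_ord2 /d /= ler10 lerN10.
- by apply: unit_of_congr E => i; rewrite /d; case: ifP; rewrite ?oppr_eq0 oner_eq0.
- exact: E.
Qed.

(** The off-diagonal entries cancel in the difference, leaving a nonnegative diagonal form. *)
Lemma hform_coupling_le z al1 al2 b1 b2 x : al1 <= al2 -> b1 <= b2 ->
  hform (coupling z al1 b1) x <= hform (coupling z al2 b2) x.
Proof.
move=> ha hb; rewrite -subr_ge0 /hform.
rewrite (_ : _ - _ =
  `|x 0 i0| ^+ 2 * rC (al2 - al1) + `|x 0 i1| ^+ 2 * rC (b2 - b1)).
  by rewrite addr_ge0 // mulr_ge0 ?exprn_ge0 // rC_ge0 subr_ge0.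
rewrite !normCK !mxE !big_ord_recl !big_ord0 !mxE !big_ord_recl !big_ord0 !mxE.
have -> : lift ord0 ord0 = i1 by apply/val_inj.
by rewrite /= /rC !rmorphB -/i0 /=; ring.
Qed.

Lemma hform_pencil_le N k (L : 'M[C]_N) (E : 'M[C]_(N, k)) (M1 M2 : 'M[C]_k)
    lam x :
  (forall y, hform M1 y <= hform M2 y) ->
  hform (pencil L E M1 lam) x <= hform (pencil L E M2 lam) x.
Proof.
move=> h; rewrite -[x]hsubmxK; move: (lsubmx x) (rsubmx x) => y p.
have hE M : hform (pencil L E M lam) (row_mx y p) =
    ((y *m (L - lam%:M) + p *m E^t*) *m y^t* + y *m E *m p^t*) 0 0 + hform M p.
  rewrite /hform /pencil mul_row_block adj_row mul_row_col.
  by rewrite [(y *m E + _) *m _]mulmxDl addrA mxE.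
by rewrite !hE lerD2l h.
Qed.

Lemma pencil_compr N k k' (L : 'M[C]_N) (E : 'M[C]_(N, k)) (M : 'M[C]_k)
    (jj : 'M[C]_(k', k)) lam (J := block_mx 1%:M 0 0 jj) :
  pencil L (E *m jj^t*) (jj *m M *m jj^t*) lam = J *m pencil L E M lam *m J^t*.
Proof.
rewrite /J /pencil tr_block_mx map_block_mx !mulmx_block adj_scalar conjC1.
by rewrite !adj0 !(mul0mx, mulmx0, mul1mx, mulmx1, addr0, add0r) adjM trmxCK.
Qed.

(** * Comparison of the coupled and the compressed pencils *)

Section Comparison.
Variables (n : nat) (f q w : nat -> R) (z : C).
Local Notation N := n.+2.
Hypothesis hf : forall m : nat, (m <= N)%N -> f m != 0.
Hypothesis hw : forall m : nat, (1 <= m <= N)%N -> 0 < w m.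

Definition coupled_pencil (al b : R) :=
  pencil (jacobi n f q w) (ends n w) (coupling z al b).
(** Keeping coordinate [j] sets the other of s and t to 0: [i1] belongs to S7, [i0] to S8. *)
Definition compressed_pencil (j : 'I_2) (al b : R) :=
  let jj : 'rV[C]_2 := delta_mx 0 j in
  pencil (jacobi n f q w) (ends n w *m jj^t*) (jj *m coupling z al b *m jj^t*).

Lemma delta2_adj (j : 'I_2) : (delta_mx 0 j : 'rV[C]_2)^t* = delta_mx j 0.
Proof.
apply/matrixP => i k; rewrite !mxE !ord1 eqxx /=.
by rewrite andbT rmorph_nat.
Qed.

Lemma delta2_unit (j : 'I_2) :
  (delta_mx 0 j : 'rV[C]_2) *m (delta_mx 0 j)^t* = 1%:M.
Proof.
rewrite delta2_adj mul_delta_mx; apply/matrixP => i k.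
by rewrite !mxE !ord1.
Qed.

Lemma mul_delta2 (v : 'rV[C]_2) (j : 'I_2) :
  v *m (delta_mx 0 j)^t* = (v 0 j)%:M.
Proof.
rewrite delta2_adj; apply/matrixP => i k.
by rewrite !ord1 [RHS]mxE -colE mxE.
Qed.

Lemma bcA_reduced a b :
  bc_reduced f (bcA_ab z a b) 1%:M (coupling z (a - (f 0)^-1) b).
Proof.
move=> u v; rewrite adj_scalar conjC1 !mulmx1.
have f0 : rC (f 0) != 0 by apply: rCf_neq0 hf _ _.
have E0 : (u + v *m coupling z (a - (f 0)^-1) b) 0 i0 =
   u 0 i0 - v 0 i0 / rC (f 0) + rC a * v 0 i0 - conjc z * v 0 i1.
  rewrite !mxE !big_ord_recl big_ord0 !mxE /= /rC rmorphB fmorphV /=.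
  by rewrite (_ : lift ord0 ord0 = i1) -/i0; [ring | apply/val_inj].
have E1 : (u + v *m coupling z (a - (f 0)^-1) b) 0 i1 =
   - (z * v 0 i0 - u 0 i1 - rC b * v 0 i1).
  rewrite !mxE !big_ord_recl big_ord0 !mxE /=.
  by rewrite (_ : lift ord0 ord0 = i1) -/i0; [ring | apply/val_inj].
split=> [h|[_ h] r].
  split=> //; apply/rowP => j; rewrite [RHS]mxE; case: (ord2P j) => ->.
    by rewrite E0 -[RHS](h i0) !mxE /=; ring.
  rewrite E1; apply/eqP; rewrite oppr_eq0 -[X in _ == X](h i1) !mxE /=.
  by apply/eqP; ring.
move: E0 E1; rewrite h !mxE => E0 /esym/eqP; rewrite oppr_eq0 => /eqP E1.
case: (ord2P r) => -> /=.
  by rewrite [RHS]E0; ring.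
by rewrite -[RHS]E1; ring.
Qed.

Lemma bcS7_reduced a b :
  bc_reduced f (bcS7 b) (delta_mx 0 i1 : 'rV_2) (coupling z a b).
Proof.
move=> u v; rewrite !mul_delta2 mul_scalar_mx.
have E1 : (u + v *m coupling z a b) 0 i1 = u 0 i1 - z * v 0 i0 + rC b * v 0 i1.
  rewrite !mxE !big_ord_recl big_ord0 !mxE /=.
  by rewrite (_ : lift ord0 ord0 = i1) -/i0; [ring | apply/val_inj].
split=> [h|[h1 h2] r].
  have v0 : v 0 i0 = 0 by rewrite -[RHS](h i0) !mxE /=; ring.
  split.
    apply/rowP => j; rewrite !mxE /=; case: (ord2P j) => -> /=.
      by rewrite mulr0 v0.
    by rewrite mulr1.
  rewrite E1 v0 [X in X%:M](_ : _ = 0) ?scalar_mx0 //; first by rewrite raddf0.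
  by apply/eqP; rewrite -oppr_eq0 -[X in _ == X](h i1) !mxE /=; apply/eqP; ring.
have v0 : v 0 i0 = 0 by rewrite h1 !mxE /= mulr0.
have := congr1 (fun B : 'M_1 => B 0 0) h2.
rewrite E1 !mxE eqxx mulr1n v0 mulr0 subr0 => /eqP.
rewrite -oppr_eq0 => /eqP h3.
case: (ord2P r) => -> /=; first by ring.
by rewrite -[RHS]h3; ring.
Qed.

Lemma bcS8_reduced a b :
  bc_reduced f (bcS8 a) (delta_mx 0 i0 : 'rV_2) (coupling z (a - (f 0)^-1) b).
Proof.
move=> u v; rewrite !mul_delta2 mul_scalar_mx.
have f0 : rC (f 0) != 0 by apply: rCf_neq0 hf _ _.
have E1 : (u + v *m coupling z (a - (f 0)^-1) b) 0 i0 =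
   u 0 i0 - v 0 i0 / rC (f 0) + rC a * v 0 i0 - conjc z * v 0 i1.
  rewrite !mxE !big_ord_recl big_ord0 !mxE /= /rC rmorphB fmorphV /=.
  by rewrite (_ : lift ord0 ord0 = i1) -/i0; [ring | apply/val_inj].
split=> [h|[h1 h2] r].
  have v1 : v 0 i1 = 0.
    by apply/eqP; rewrite -oppr_eq0 -[X in _ == X](h i1) !mxE /=; apply/eqP; ring.
  split.
    apply/rowP => j; rewrite !mxE /=; case: (ord2P j) => -> /=.
      by rewrite mulr1.
    by rewrite mulr0 v1.
  rewrite E1 v1 [X in X%:M](_ : _ = 0); first by rewrite raddf0.
  by rewrite -[RHS](h i0) !mxE /=; ring.
have v1 : v 0 i1 = 0 by rewrite h1 !mxE /= mulr0.
have := congr1 (fun B : 'M_1 => B 0 0) h2.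
rewrite E1 !mxE eqxx mulr1n v1 mulr0 subr0 => h3.
case: (ord2P r) => -> /=; last by ring.
by rewrite -[RHS]h3; ring.
Qed.

Lemma bcA_spectrum a b r c : coupling_index z (a - (f 0)^-1) b r c ->
  exists s, [/\ is_spectrum N f q w (bcA_ab z a b) s, (size s + r)%N = N &
    inertia (coupled_pencil (a - (f 0)^-1) b) c s].
Proof.
case=> [T [d [Tu TE <- <-]]].
have := @reduced_spectrum _ _ _ q _ hf hw _ _ 1%:M _ T d _ (@bcA_reduced a b).
rewrite /spectral_index adj_scalar conjC1 !mulmx1 !mul1mx; apply => //.
exact: coupling_herm.
Qed.

Lemma diag1_row (x : R) : (rC x)%:M = diag_mx (\row_i rC x) :> 'M[C]_1.
Proof. by apply/matrixP => i j; rewrite !mxE !ord1. Qed.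

Lemma compress_spectrum P (j : 'I_2) al b (x : R) :
  bc_reduced f P (delta_mx 0 j : 'rV_2) (coupling z al b) ->
  coupling z al b j j = rC x ->
  exists s, [/\ is_spectrum N f q w P s, (size s + (x == 0)%R)%N = N &
    inertia (compressed_pencil j al b) (x <= 0)%R s].
Proof.
move=> hP Mx.
have := @reduced_spectrum _ _ _ q _ hf hw _ _ _ _ 1%:M (fun=> x) _ hP.
rewrite /spectral_index !card_ord1; apply; first exact: delta2_unit.
- exact: coupling_herm.
- exact: unitmx1.
by rewrite mul1mx adj_scalar conjC1 mulmx1 mul_delta2 -rowE mxE Mx diag1_row.
Qed.

Lemma bcA_inertia a b r c s : coupling_index z (a - (f 0)^-1) b r c ->
  is_spectrum N f q w (bcA_ab z a b) s ->
  [/\ sorted <=%R s, (size s + r)%N = N &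
      inertia (coupled_pencil (a - (f 0)^-1) b) c s].
Proof.
move=> /bcA_spectrum [t [tP tsz ti]] sP.
by rewrite (spectrum_unique sP tP); split=> //; case: tP.
Qed.

(** The compression to s = 0 keeps only the entry [b], so one spectrum of S7 can be compared with
    A(a, b22) for every a. *)
Lemma bcS7_inertia al b s : is_spectrum N f q w (bcS7 b) s ->
  [/\ sorted <=%R s, (size s + (b == 0)%R)%N = N &
      inertia (compressed_pencil i1 al b) (b <= 0)%R s].
Proof.
have [|t [tP tsz ti]] :=
  @compress_spectrum (bcS7 b) i1 al b b (@bcS7_reduced al b).
  by rewrite mxE.
by move=> sP; rewrite (spectrum_unique sP tP); split=> //; case: tP.
Qed.

Lemma bcS8_inertia a b s : is_spectrum N f q w (bcS8 a) s ->
  [/\ sorted <=%R s, (size s + (a - (f 0)^-1 == 0)%R)%N = N &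
      inertia (compressed_pencil i0 (a - (f 0)^-1) b) (a - (f 0)^-1 <= 0)%R s].
Proof.
pose al := a - (f 0)^-1.
have [|t [tP tsz ti]] :=
  @compress_spectrum (bcS8 a) i0 al b al (@bcS8_reduced a b).
  by rewrite mxE.
by move=> sP; rewrite (spectrum_unique sP tP); split=> //; case: tP.
Qed.

Lemma inertia_coupling_le al1 al2 b1 b2 c1 c2 s1 s2 l :
  inertia (coupled_pencil al1 b1) c1 s1 -> inertia (coupled_pencil al2 b2) c2 s2 ->
  al1 <= al2 -> b1 <= b2 -> (nlt l s2 + c2 <= nlt l s1 + c1)%N.
Proof.
move=> i1' i2' ha hb; apply: inertia_mono i1' i2' => x.
by apply: hform_pencil_le => y; apply: hform_coupling_le.
Qed.

Lemma inertia_coupling_compr j al b c c' s s' l :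
  inertia (coupled_pencil al b) c s -> inertia (compressed_pencil j al b) c' s' ->
  (nlt l s' + c' <= nlt l s + c)%N /\ (nlt l s + c <= nlt l s' + c' + 1)%N.
Proof.
move=> ki ki'; pose jj : 'rV[C]_2 := delta_mx 0 j.
pose J : 'M[C]_(N + 1, N + 2) := block_mx 1%:M 0 0 jj.
have Jf : row_free J.
  apply/row_freeP; exists (J^t*).
  rewrite /J tr_block_mx map_block_mx mulmx_block adj_scalar conjC1 !adj0.
  rewrite !(mul0mx, mulmx0, mul1mx, mulmx1, addr0, add0r) delta2_unit.
  by rewrite -scalar_mx_block.
have := inertia_compr Jf (pencil_compr _ _ _ jj (rC l)) ki ki'.
by rewrite subnDl.
Qed.

End Comparison.
End Concrete.

(** * Eigenvalue counts and the four interlacing statements *)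

Theorem theorem3p5 (R : rcfType) (N : nat) (f q w : nat -> R) (z : R[i])
  (hN : (2 <= N)%N)
  (hf : forall n : nat, (n <= N)%N -> f n != 0)
  (hw : forall n : nat, (1 <= n <= N)%N -> 0 < w n)
  (hz : z != 0) :
  (* number of eigenvalues *)
  (forall a12 b22 : R, exists s : seq R,
     is_spectrum N f q w (bcA_ab z a12 b22) s /\
     size s = (if b22 * (a12 - (f 0%N)^-1) != normsq z then N else N.-1)) /\
  (forall b22 : R, exists s : seq R,
     is_spectrum N f q w (bcS7 b22) s /\
     size s = (if b22 != 0 then N else N.-1)) /\
  (forall a12 : R, exists s : seq R,
     is_spectrum N f q w (bcS8 a12) s /\
     size s = (if a12 - (f 0%N)^-1 != 0 then N else N.-1)) /\
  (* (i) *)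
  (forall (b22 a1 a2 : R) (s1 s2 s7 : seq R),
     b22 = 0 -> a1 < a2 ->
     is_spectrum N f q w (bcA_ab z a1 b22) s1 ->
     is_spectrum N f q w (bcA_ab z a2 b22) s2 ->
     is_spectrum N f q w (bcS7 b22) s7 ->
     (forall n : nat, (n <= N - 2)%N ->
        nth 0 s1 n <= nth 0 s2 n /\ nth 0 s2 n <= nth 0 s7 n /\
        nth 0 s7 n <= nth 0 s1 n.+1) /\
     nth 0 s1 N.-1 <= nth 0 s2 N.-1) /\
  (* (ii) *)
  (forall (b22 a1 a2 a3 a4 : R) (s1 s2 s3 s4 s7 : seq R),
     b22 != 0 ->
     a1 < a2 -> a2 <= normsq z / b22 + (f 0%N)^-1 ->
     normsq z / b22 + (f 0%N)^-1 < a3 -> a3 < a4 ->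
     is_spectrum N f q w (bcA_ab z a1 b22) s1 ->
     is_spectrum N f q w (bcA_ab z a2 b22) s2 ->
     is_spectrum N f q w (bcA_ab z a3 b22) s3 ->
     is_spectrum N f q w (bcA_ab z a4 b22) s4 ->
     is_spectrum N f q w (bcS7 b22) s7 ->
     (forall n : nat, (n <= N - 2)%N ->
        nth 0 s3 n <= nth 0 s4 n /\ nth 0 s4 n <= nth 0 s7 n /\
        nth 0 s7 n <= nth 0 s1 n /\ nth 0 s1 n <= nth 0 s2 n /\
        nth 0 s2 n <= nth 0 s3 n.+1) /\
     (nth 0 s3 N.-1 <= nth 0 s4 N.-1 /\ nth 0 s4 N.-1 <= nth 0 s7 N.-1 /\
      nth 0 s7 N.-1 <= nth 0 s1 N.-1) /\
     (a2 < normsq z / b22 + (f 0%N)^-1 -> nth 0 s1 N.-1 <= nth 0 s2 N.-1)) /\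
  (* (iii) *)
  (forall (a12 b1 b2 : R) (s1 s2 s8 : seq R),
     a12 - (f 0%N)^-1 = 0 -> b1 < b2 ->
     is_spectrum N f q w (bcA_ab z a12 b1) s1 ->
     is_spectrum N f q w (bcA_ab z a12 b2) s2 ->
     is_spectrum N f q w (bcS8 a12) s8 ->
     (forall n : nat, (n <= N - 2)%N ->
        nth 0 s1 n <= nth 0 s2 n /\ nth 0 s2 n <= nth 0 s8 n /\
        nth 0 s8 n <= nth 0 s1 n.+1) /\
     nth 0 s1 N.-1 <= nth 0 s2 N.-1) /\
  (* (iv) *)
  (forall (a12 b1 b2 b3 b4 : R) (s1 s2 s3 s4 s8 : seq R),
     a12 - (f 0%N)^-1 != 0 ->
     b1 < b2 -> b2 <= normsq z / (a12 - (f 0%N)^-1) ->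
     normsq z / (a12 - (f 0%N)^-1) < b3 -> b3 < b4 ->
     is_spectrum N f q w (bcA_ab z a12 b1) s1 ->
     is_spectrum N f q w (bcA_ab z a12 b2) s2 ->
     is_spectrum N f q w (bcA_ab z a12 b3) s3 ->
     is_spectrum N f q w (bcA_ab z a12 b4) s4 ->
     is_spectrum N f q w (bcS8 a12) s8 ->
     (forall n : nat, (n <= N - 2)%N ->
        nth 0 s3 n <= nth 0 s4 n /\ nth 0 s4 n <= nth 0 s8 n /\
        nth 0 s8 n <= nth 0 s1 n /\ nth 0 s1 n <= nth 0 s2 n /\
        nth 0 s2 n <= nth 0 s3 n.+1) /\
     (nth 0 s3 N.-1 <= nth 0 s4 N.-1 /\ nth 0 s4 N.-1 <= nth 0 s8 N.-1 /\
      nth 0 s8 N.-1 <= nth 0 s1 N.-1) /\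
     (b2 < normsq z / (a12 - (f 0%N)^-1) -> nth 0 s1 N.-1 <= nth 0 s2 N.-1)).
Proof.
case: N hN hf hw => [|[|n]] // _ hf hw.
have nz := normsq_gt0 hz.
split.
  move=> a b; set al := a - _.
  (* For b = 0 there is no pivot in t, but then b al = 0 differs from |z|^2 and no eigenvalue is
     lost. *)
  have [b0|b0] := eqVneq b 0.
    have ci := @coupling_index_b0 _ _ al hz; rewrite -b0 in ci.
    have [s [sP sz _]] := bcA_spectrum q hf hw ci; exists s; split=> //.
    by rewrite b0 mul0r ifT ?lt_eqF // -sz addn0.
  have [s [sP sz _]] := bcA_spectrum q hf hw (@coupling_index_b _ z al b b0).
  exists s; split=> //; move: sz.
  rewrite -[b * al == _](_ : (al - normsq z / b == 0) = _); last first.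
    by rewrite subr_eq0 -(inj_eq (mulfI b0)) mulrCA divff // mulr1.
  by case: eqP => _ /=; lia.
split.
  move=> b; have [|s [sP sz _]] := compress_spectrum q hf hw (bcS7_reduced f z 0 b)
    (x := b); first by rewrite mxE.
  by exists s; split=> //; move: sz; case: eqP => _ /=; lia.
split.
  move=> a; have [|s [sP sz _]] := compress_spectrum q hf hw (bcS8_reduced z hf a 0)
    (x := a - (f 0%N)^-1).
    by rewrite mxE.
  by exists s; split=> //; move: sz; case: eqP => _ /=; lia.
split.
  move=> b a1 a2 s1 s2 s7 -> a12 sp1 sp2 sp7.
  have [so1 z1 k1] := bcA_inertia hf hw (@coupling_index_b0 _ _ _ hz) sp1.
  have [so2 z2 k2] := bcA_inertia hf hw (@coupling_index_b0 _ _ _ hz) sp2.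
  have [so7 z7 _] := bcS7_inertia z hf hw 0 sp7.
  have [_ _ k71] := bcS7_inertia z hf hw (a1 - (f 0%N)^-1) sp7.
  have [_ _ k72] := bcS7_inertia z hf hw (a2 - (f 0%N)^-1) sp7.
  rewrite eqxx addn1 in z7; rewrite addn0 in z1; rewrite addn0 in z2.
  case: z7 => z7; rewrite subSS subSS subn0; apply: interlacing_regular => //.
  (* All offsets equal 1 and cancel: [M] is indefinite, and the compressed entry b22 = 0 is counted
     as well. *)
  move=> l; have := inertia_coupling_le l k1 k2 (lerB (ltW a12) (lexx _)) (lexx _).
  have := inertia_coupling_compr l k1 k71; have := inertia_coupling_compr l k2 k72.
  rewrite lexx /=; move: (nlt l s1) (nlt l s2) (nlt l s7); clear => x1 x2 x7.
  by move=> [? ?] [? ?] ?; split; lia.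
split.
  move=> b a1 a2 a3 a4 s1 s2 s3 s4 s7 b0 a12 a2s a3s a34 sp1 sp2 sp3 sp4 sp7.
  have ci a := @coupling_index_b _ z (a - (f 0%N)^-1) b b0.
  have [so1 z1 k1] := bcA_inertia hf hw (ci _) sp1.
  have [so2 z2 k2] := bcA_inertia hf hw (ci _) sp2.
  have [so3 z3 k3] := bcA_inertia hf hw (ci _) sp3.
  have [so4 z4 k4] := bcA_inertia hf hw (ci _) sp4.
  have [so7 z7 _] := bcS7_inertia z hf hw 0 sp7.
  have [_ _ k71] := bcS7_inertia z hf hw (a1 - (f 0%N)^-1) sp7.
  have [_ _ k74] := bcS7_inertia z hf hw (a4 - (f 0%N)^-1) sp7.
  have d1 : a1 - (f 0%N)^-1 - normsq z / b < 0 by lra.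
  (* At the threshold this entry is 0: it still counts in the offset, while [s2] loses an
     eigenvalue. *)
  have d2 : a2 - (f 0%N)^-1 - normsq z / b <= 0 by lra.
  have d3 : 0 < a3 - (f 0%N)^-1 - normsq z / b by lra.
  have d4 : 0 < a4 - (f 0%N)^-1 - normsq z / b by lra.
  rewrite (negPf b0) (lt_eqF d1) (gt_eqF d3) (gt_eqF d4) !addn0 in z1 z3 z4 z7.
  rewrite (ltW d1) in k1; rewrite d2 in k2.
  rewrite leNgt d3 in k3; rewrite leNgt d4 in k4.
  have mono (x y : R) : x < y -> x - (f 0%N)^-1 <= y - (f 0%N)^-1 by lra.
  have a23 : a2 < a3 by lra.
  rewrite subSS subSS subn0.
  have [||H1 [H2 H3]] := interlacing_singular so1 so2 so3 so4 so7 z1 z2 _ z3 z4 z7.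
  - by case: (_ == _).
  (* Pencils above the threshold have the offset of S7, those below or at it have one more. That
     extra 1 makes [s1] lie above [s7] and yields the index shift between [s2] and [s3]. *)
  - move=> l; have := inertia_coupling_le l k1 k2 (mono _ _ a12) (lexx _).
    have := inertia_coupling_le l k2 k3 (mono _ _ a23) (lexx _).
    have := inertia_coupling_le l k3 k4 (mono _ _ a34) (lexx _).
    have := inertia_coupling_compr l k1 k71; have := inertia_coupling_compr l k4 k74.
    move: (nlt l s1) (nlt l s2) (nlt l s3) (nlt l s4) (nlt l s7).
    move: (nat_of_bool (b <= 0)) => /=; clear => c x1 x2 x3 x4 x7.
    by move=> [? ?] [? ?] ? ? ?; split; lia.
  do 2!split=> //; move=> a2s'; apply: H3; rewrite lt_eqF //; lra.
split.
  move=> a b1 b2 s1 s2 s8 al0 b12 sp1 sp2 sp8.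
  have ci b := @coupling_index_a0 _ z b hz; rewrite -al0 in ci.
  have [so1 z1 k1] := bcA_inertia hf hw (ci _) sp1.
  have [so2 z2 k2] := bcA_inertia hf hw (ci _) sp2.
  have [so8 z8 k81] := bcS8_inertia z hf hw b1 sp8.
  have [_ _ k82] := bcS8_inertia z hf hw b2 sp8.
  rewrite al0 eqxx addn1 in z8; rewrite addn0 in z1; rewrite addn0 in z2.
  case: z8 => z8; rewrite subSS subSS subn0; apply: interlacing_regular => //.
  move=> l; have := inertia_coupling_le l k1 k2 (lexx _) (ltW b12).
  have := inertia_coupling_compr l k1 k81; have := inertia_coupling_compr l k2 k82.
  rewrite al0 lexx /=; move: (nlt l s1) (nlt l s2) (nlt l s8); clear => x1 x2 x8.
  by move=> [? ?] [? ?] ?; split; lia.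
move=> a b1 b2 b3 b4 s1 s2 s3 s4 s8 al0 b12 b2s b3s b34 sp1 sp2 sp3 sp4 sp8.
have ci b := @coupling_index_a _ z (a - (f 0%N)^-1) b al0.
have [so1 z1 k1] := bcA_inertia hf hw (ci _) sp1.
have [so2 z2 k2] := bcA_inertia hf hw (ci _) sp2.
have [so3 z3 k3] := bcA_inertia hf hw (ci _) sp3.
have [so4 z4 k4] := bcA_inertia hf hw (ci _) sp4.
have [so8 z8 k81] := bcS8_inertia z hf hw b1 sp8.
have [_ _ k84] := bcS8_inertia z hf hw b4 sp8.
(* From here on only the position of the b's relative to the threshold [e] matters. *)
move: (normsq z / _) b2s b3s z1 z2 z3 z4 k1 k2 k3 k4 {ci nz} => e b2s b3s.
move=> z1 z2 z3 z4 k1 k2 k3 k4.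
have d1 : b1 - e < 0 by lra.
have d2 : b2 - e <= 0 by lra.
have d3 : 0 < b3 - e by lra.
have d4 : 0 < b4 - e by lra.
rewrite (negPf al0) (lt_eqF d1) (gt_eqF d3) (gt_eqF d4) !addn0 in z1 z3 z4 z8.
rewrite (ltW d1) in k1; rewrite d2 in k2.
rewrite [b3 - e <= 0]leNgt d3 in k3; rewrite [b4 - e <= 0]leNgt d4 in k4.
have b23 : b2 < b3 by lra.
rewrite subSS subSS subn0.
have [||H1 [H2 H3]] := interlacing_singular so1 so2 so3 so4 so8 z1 z2 _ z3 z4 z8.
- by case: (_ == _).
- move=> l; have := inertia_coupling_le l k1 k2 (lexx _) (ltW b12).
  have := inertia_coupling_le l k2 k3 (lexx _) (ltW b23).
  have := inertia_coupling_le l k3 k4 (lexx _) (ltW b34).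
  have := inertia_coupling_compr l k1 k81; have := inertia_coupling_compr l k4 k84.
  move: (nlt l s1) (nlt l s2) (nlt l s3) (nlt l s4) (nlt l s8).
  move: (nat_of_bool (a - (f 0%N)^-1 <= 0)) => /=; clear => c x1 x2 x3 x4 x8.
  by move=> [? ?] [? ?] ? ? ?; split; lia.
do 2!split=> //; move=> b2s'; apply: H3; rewrite lt_eqF //; lra.
Qed.
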